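(* Let $\mathfrak g$ be a complex semi-simple Lie algebra, identified with its dual using its Killing form $\langle\cdot|\cdot\rangle$, and let $\mathcal O$ be a nilpotent adjoint orbit of $\mathfrak g$, with canonical triple $(h,e,f)$. Let $\mathfrak n\in\mathcal N_h$ and $N:=e+\mathfrak n^\perp$. Then the transverse Poisson structure on $N$, in terms of the linear coordinates $q_1,\dots,q_k$, is a polynomial Poisson structure that is quasi-homogeneous of quasi-degree $-2$ with respect to the quasi-degrees $n_1+2,\dots,n_k+2$ (i.e. $\varpi(q_i)=n_i+2$), where $n_1,\dots,n_k$ denote the highest weights of $\mathfrak g$ as an $\mathfrak s$-module.
   Context: The Lie-Poisson structure on $\mathfrak g$ is $\{F,G\}(y):=\langle y|[dF(y),dG(y)]\rangle$, where differentials are viewed as elements of $\mathfrak g\cong\mathfrak g^*$ via the Killing form; $\perp$ is the orthogonal complement for the Killing form; $\mathfrak g(e)$ is the centralizer of $e$ in $\mathfrak g$. Canonical triple: fix a Cartan subalgebra $\mathfrak h$ of $\mathfrak g$ and a basis of simple roots $\Pi(\mathfrak h)$. The canonical triple $(h,e,f)$ of $\mathcal O$ satisfies: (1) $[h,e]=2e$, $[h,f]=-2f$, $[e,f]=h$; (2) $h\in\mathfrak h$ and $\alpha(h)\in\{0,1,2\}$ for every $\alpha\in\Pi(\mathfrak h)$; (3) $\mathcal O=\mathbf G\cdot e$, where $\mathbf G$ is the adjoint group. $\mathfrak s$ is the Lie subalgebra of $\mathfrak g$ generated by $h,e,f$; as an $\mathfrak s$-module, $\mathfrak g=\bigoplus_{j=1}^kV_{n_j}$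 with $V_{n_j}$ simple of highest weight $n_j$ (dimension $n_j+1$), and $k=\dim\mathfrak g(e)$. $\mathcal N_h$ is the set of all $\operatorname{ad}_h$-invariant subspaces $\mathfrak n$ of $\mathfrak g$ that are complementary to $\mathfrak g(e)$ in $\mathfrak g$. For such $\mathfrak n$, $N=e+\mathfrak n^\perp$ is a transverse slice to $\mathcal O$ at $e$. Choose a basis $(Z_1,\dots,Z_k)$ of $\mathfrak g(e)$ where $Z_i$ is a highest weight vector of weight $n_i$ (so $[h,Z_i]=n_iZ_i$), and a basis $(X_1,\dots,X_{2r})$ of $\mathfrak n$ consisting of $\operatorname{ad}_h$-weight vectors. The coordinates on $N$ are $q_i(y):=\langle y-e|Z_i\rangle$, $1\le i\le k$. The transverse Poisson structure on $N$ is the one obtained by Dirac reduction of the Lie-Poisson structure: its Poisson matrix in the coordinates $q_1,\dots,q_k$ at $n\in N$ is $A(n)+B(n)C(n)^{-1}B(n)^\top$, where $A_{ij}(n)=\langle n|[Z_i,Z_j]\rangle$, $B_{im}(n)=\langle n|[Z_i,X_m]\rangle$, $C_{lm}(n)=\langle n|[X_l,X_m]\rangle$ ($C$ is invertible near $e$). Quasi-homogeneity: given non-negative integers $\nu=(\nu_1,\dots,\nu_k)$, a polynomial $P\in\mathbb C[q_1,\dots,q_k]$ is quasi-homogeneous of quasi-degree $\varpi(P)=\kappa$ (relative to $\nu$) if $P(t^{\nu_1}q_1,\dots,t^{\nu_k}q_k)=t^\kappa P(q_1,\dots,q_k)$ for all $t\in\mathbb C^*$. A polynomial Poisson structure is quasi-homogeneous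 of quasi-degree $\kappa\in\mathbb Z$ (relative to $\nu$) if, for all $i,j$, $\{q_i,q_j\}$ is quasi-homogeneous of quasi-degree $\nu_i+\nu_j+\kappa$ (the zero polynomial being quasi-homogeneous of every quasi-degree). *)

(* Defs.v *)
From HB Require Import structures.
From mathcomp Require Import all_boot all_order all_algebra.
From mathcomp Require Import complex.
(* The notations of mpoly clash with those of MathComp-Analysis. *)
From mathcomp Require Import -(notations) mpoly.
From mathcomp Require Import all_classical all_reals topology normedtype sequences.

Set Implicit Arguments.
Unset Strict Implicit.
Unset Printing Implicit Defensive.

Import Order.TTheory GRing.Theory Num.Theory numFieldNormedType.Exports.

Local Open Scope classical_set_scope.
Local Open Scope ring_scope.

Reserved Notation "⁅ x , y ⁆" (at level 0, x, y at level 99).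

HB.mixin Record isLieAlgebra (K : fieldType) V of Vector K V := {
  lie : V -> V -> V;
  lie_linear_l : forall y, linear (fun x => lie x y);
  lie_linear_r : forall x, linear (lie x);
  lie_alt : forall x, lie x x = 0;
  lie_jacobi : forall x y z,
    lie x (lie y z) + lie y (lie z x) + lie z (lie x y) = 0
}.

(* Vector makes these finite-dimensional. *)
#[short(type="lieAlgType")]
HB.structure Definition LieAlgebra (K : fieldType) :=
  {V of isLieAlgebra K V & Vector K V}.

Notation "⁅ x , y ⁆" := (lie x y) : ring_scope.

Section LieAlgebra.
Variables (K : fieldType) (g : lieAlgType K).
Implicit Types (x y h e f : g) (U I H s : {vspace g}).

Definition ad x : 'End(g) := linfun (lie x).

Definition killing x y : K :=
  let b := vbasis {:g} in \tr (passmx.mxof b b (ad x \o ad y)%VF).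

Definition killing_perp U : set g :=
  [set y | forall x, x \in U -> killing y x = 0].

(* The span of all brackets of U and W; by bilinearity bases suffice. *)
Definition lie_prod U W : {vspace g} :=
  <<[seq ⁅x, y⁆ | x <- vbasis U, y <- vbasis W]>>%VS.

Definition is_subalgebra U := (lie_prod U U <= U)%VS.
Definition is_ideal U := (lie_prod {:g} U <= U)%VS.

Definition lie_solvable U :=
  exists m, iter m (fun W => lie_prod W W) U = 0%VS.
Definition lie_nilpotent U :=
  exists m, iter m (lie_prod U) U = 0%VS.

Definition lie_semisimple :=
  forall I, is_ideal I -> lie_solvable I -> I = 0%VS.

Definition centralizer x : {vspace g} := lker (ad x).

Definition ad_nilpotent x := exists m, forall y, iter m (lie x) y = 0.

Definition cartan_subalgebra H :=
  [/\ is_subalgebra H,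
      lie_nilpotent H &
      forall x, (forall y, y \in H -> ⁅x, y⁆ \in H) -> x \in H].

(* Eigenvectors, not generalized ones: in a semisimple Lie algebra a Cartan
   subalgebra acts diagonalizably. *)
Definition is_root H (alpha : 'Hom(subvs_of H, K^o)) :=
  alpha != 0 /\
  exists2 x : g, x != 0 & forall t : subvs_of H, ⁅vsval t, x⁆ = (alpha t : K) *: x.

Definition simple_roots H (Pi : seq 'Hom(subvs_of H, K^o)) :=
  [/\ basis_of fullv Pi,
      forall alpha, alpha \in Pi -> is_root alpha &
      forall beta : 'Hom(subvs_of H, K^o), is_root beta -> exists c : 'I_(size Pi) -> nat,
        beta = \sum_(i < size Pi) Pi`_i *+ c i \/ beta = - \sum_(i < size Pi) Pi`_i *+ c i].

Definition generated_subalgebra (xs : seq g) s :=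
  [/\ is_subalgebra s,
      {subset xs <= s} &
      forall U, is_subalgebra U -> {subset xs <= U} -> (s <= U)%VS].

Definition submodule s U :=
  forall x u, x \in s -> u \in U -> ⁅x, u⁆ \in U.

Definition simple_submodule s U :=
  [/\ submodule s U,
      U != 0%VS &
      forall W, submodule s W -> (W <= U)%VS -> W = 0%VS \/ W = U].

Definition has_highest_weight h e U (n : nat) :=
  exists v : g, [/\ v \in U, v != 0, ⁅e, v⁆ = 0 & ⁅h, v⁆ = n%:R *: v].

Definition simple_decomposition h e s k (n : 'I_k -> nat) :=
  exists V : 'I_k -> {vspace g},
    [/\ directv (\sum_j V j),
        (\sum_j V j)%VS = fullv &
        forall j, simple_submodule s (V j) /\ has_highest_weight h e (V j) (n j)].

Definition in_Nh h e U :=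
  [/\ forall x, x \in U -> ⁅h, x⁆ \in U,
      directv (U + centralizer e) &
      (U + centralizer e)%VS = fullv].

Definition slice e U : set g := [set e + z | z in killing_perp U].

Section Dirac.
Variables (k m : nat) (e : g) (Z : k.-tuple g) (X : m.-tuple g).

Definition slice_coord y (i : 'I_k) : K := killing (y - e) (tnth Z i).

(* The Lie-Poisson bracket of the linear functions <.|a> and <.|b> at y is
   <y|[a, b]>. A, B, C are these brackets for the coordinates <.|Z i> and the
   constraints <.|X l>, and transverse_matrix is the Dirac bracket; the sign is
   + because the bracket of X l with Z j is - B j l. *)
Definition dirac_A y : 'M[K]_k :=
  \matrix_(i, j) killing y ⁅tnth Z i, tnth Z j⁆.
Definition dirac_B y : 'M[K]_(k, m) :=
  \matrix_(i, j) killing y ⁅tnth Z i, tnth X j⁆.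
Definition dirac_C y : 'M[K]_m :=
  \matrix_(i, j) killing y ⁅tnth X i, tnth X j⁆.

Definition transverse_matrix y : 'M[K]_k :=
  dirac_A y + dirac_B y *m invmx (dirac_C y) *m (dirac_B y)^T.

End Dirac.

End LieAlgebra.

Section AdjointGroup.
Variables (K : numFieldType) (g : lieAlgType K).
Implicit Types (u phi psi : 'End(g)) (x h e f : g) (O : set g).

(* phi = exp u, the exponential series converging pointwise in coordinates. *)
Definition is_exp u phi :=
  let coords : g -> 'rV[K]_(\dim {:g}) := passmx.rVof (vbasis {:g}) in
  forall x, series (fun m => (m`!%:R)^-1 *: coords (iter m u x)) @ \oo
              --> coords (phi x).

(* Closed under inverses, since exp (- ad x) = exp (ad (- x)). *)
Inductive adjoint_group : 'End(g) -> Prop :=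
| adjoint_id : adjoint_group \1%VF
| adjoint_exp x phi psi :
    is_exp (ad x) phi -> adjoint_group psi -> adjoint_group (phi \o psi)%VF.

Definition adjoint_orbit x : set g :=
  [set phi x | phi in [set phi | adjoint_group phi]].

Definition nilpotent_orbit O :=
  exists2 x, ad_nilpotent x & O = adjoint_orbit x.

Definition canonical_triple (H : {vspace g}) (Pi : seq 'Hom(subvs_of H, K^o))
    O h e f :=
  [/\ [/\ ⁅h, e⁆ = 2 *: e, ⁅h, f⁆ = - 2 *: f & ⁅e, f⁆ = h],
      h \in H,
      forall alpha, alpha \in Pi -> alpha (vsproj H h) \in [:: 0; 1; 2] &
      O = adjoint_orbit e].

End AdjointGroup.

Section PolynomialPoisson.
Variables (K : fieldType) (k : nat).
Local Notation pol := (mpoly k K).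
Local Notation "''q_' i" := (mpolyX K (mnm1 i)) (at level 8, i at level 2).
Implicit Types (nu : 'I_k -> nat) (kappa : int) (p : pol).

Definition is_poisson_bracket (br : pol -> pol -> pol) :=
  [/\ forall b, linear (fun a => br a b),
      forall a, linear (br a),
      forall a, br a a = 0,
      forall a b c, br a (b * c) = br a b * c + b * br a c &
      forall a b c, br a (br b c) + br b (br c a) + br c (br a b) = 0].

Definition quasi_homogeneous nu kappa p :=
  forall t : K, t != 0 ->
    comp_mpoly [tuple t ^+ nu i *: 'q_i | i < k] p = t ^ kappa *: p.

Definition quasi_homogeneous_poisson nu kappa (br : pol -> pol -> pol) :=
  forall i j, quasi_homogeneous nu ((nu i)%:Z + (nu j)%:Z + kappa)
                                (br 'q_i 'q_j).

(* br is the transverse Poisson structure on the slice e + U^perp: defined near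
   e, and given by the Dirac matrix wherever the latter makes sense. *)
Definition transverse_poisson (g : lieAlgType K) (e : g) (U : {vspace g}) m
    (Z : k.-tuple g) (X : m.-tuple g) (br : pol -> pol -> pol) :=
  dirac_C X e \in unitmx /\
  forall y, slice e U y -> dirac_C X y \in unitmx ->
    forall i j, transverse_matrix Z X y i j =
                meval (slice_coord e Z y) (br 'q_i 'q_j).

End PolynomialPoisson.

(* Main.v *)
Require Import Defs.
From HB Require Import structures.
From mathcomp Require Import all_boot all_order all_algebra.
From mathcomp Require Import complex.
From mathcomp Require Import -(notations) mpoly.
From mathcomp Require Import all_classical all_reals topology normedtype sequences.
From mathcomp Require Import spectral ring zify.

Set Implicit Arguments.
Unset Strict Implicit.
Unset Printing Implicit Defensive.

Import passmx.
Import Order.TTheory GRing.Theory Num.Theory numFieldNormedType.Exports.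
Local Open Scope classical_set_scope.
Local Open Scope ring_scope.

(** The transverse Poisson structure is the bracket whose values on the
    coordinates are the entries of [A + B C^-1 B^T], so three things have to be
    seen: these entries are polynomials, they satisfy the Jacobi identity, and
    they have the right weights.

    Non-degeneracy. Since [<e|[x,y]> = <[e,x]|y>], a combination [x] of the [X l]
    in the kernel of the constraint matrix [C(e)] has [[e,x]] orthogonal to [g];
    if the Killing form is non-degenerate, [x] centralizes [e], hence [x = 0]
    because [U] is a complement of the centralizer ([dirac_C_unit]). With a Cartan
    subalgebra [H] and simple roots at hand, non-degeneracy
    ([killing_nondegenerate]) has a direct proof. Let [I] be the radical of the
    form. On the elements of [H] where the simple roots are real, the form is
    positive definite, being a trace of squares of real eigenvalues; writing an
    element of [H] as [a + ib] and pairing it with [a - ib] shows that [I] meets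
    [H] trivially. Take [t] in [H] on which every simple root is [1]. No root
    vanishes on [t], so [ad t] is injective on [I]. The generalized eigenvectors of
    [ad t] in [I] then have non-zero eigenvalues: they are ad-nilpotent, closed
    under bracket, and they span [I]. Engel's theorem provides a non-zero element
    of [I] that centralizes [I]; the center of [I] is an abelian ideal of [g],
    contradicting semisimplicity.

    Polynomiality. On the slice, [y |-> <y|x>] is an affine function of the
    coordinates, [slice_form x]. If [[h,x] = z x], every monomial of it has
    quasi-degree [z + 2]: its constant term [<e|x>] vanishes unless [z = -2], and
    [q_i] occurs only if [z = n_i]. So [det C] is multiplied by a scalar under the
    scaling of the variables. Its constant term [det C(e)] is not zero, so that
    scalar is [1], and a polynomial invariant under a scaling with positive
    exponents is constant ([det_constraint_const]). Hence [C^-1] is polynomial.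

    Jacobi identity. The rows of [M = (1 | - B C^-1)] express the corrections of
    the [Z i] by elements of [U] that make their Hamiltonian vector fields tangent
    to the slice, and [A + B C^-1 B^T = M L M^T], where [L] is the matrix of the
    forms [slice_form [T_a,T_b]] for the basis [T = (Z, X)] of [g]. As [M L]
    vanishes in the [X] columns, differentiating [M L M^T] only differentiates [L],
    and the Jacobi sum of the entries becomes a combination of values of
    [slice_form] on Jacobi sums of [g] ([reduced_mx_jacobi]).

    Weights. The entries of [A], [B] and [C^-1] have quasi-degrees [n_i + n_j + 2],
    [n_i + w_l + 2] and [- (w_l + w_m + 2)], where [w_l] is the weight of [X l]; the
    [w_l] cancel in [B C^-1 B^T]. They have to be integers for this to make sense,
    which holds because the simple roots take integral values on [h]
    ([cartan_eigenvalue_int]). *)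

(** * Lie brackets and the Killing form *)

Section LieBasics.
Variables (K : fieldType) (g : lieAlgType K).
Implicit Types (x y z : g).

HB.instance Definition _ x :=
  GRing.isLinear.Build K g g *:%R (lie x) (lie_linear_r x).

Lemma lie_anti x y : ⁅x, y⁆ = - ⁅y, x⁆.
Proof.
have lD u v w : ⁅u + v, w⁆ = ⁅u, w⁆ + ⁅v, w⁆.
  by have := lie_linear_l w 1 u v; rewrite !scale1r.
have := lie_alt (x + y).
rewrite lD !linearD /= !lie_alt add0r addr0 => /eqP.
by rewrite addr_eq0 => /eqP.
Qed.

Lemma lieZl (c : K) x y : ⁅c *: x, y⁆ = c *: ⁅x, y⁆.
Proof. by rewrite lie_anti linearZ /= -scalerN -lie_anti. Qed.

Lemma lieDl x y z : ⁅x + y, z⁆ = ⁅x, z⁆ + ⁅y, z⁆.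
Proof. by rewrite lie_anti linearD opprD /= -!lie_anti. Qed.

Lemma lieNl x y : ⁅- x, y⁆ = - ⁅x, y⁆.
Proof. by rewrite lie_anti linearN /= (lie_anti x). Qed.

Lemma lie0l y : ⁅0, y⁆ = 0.
Proof. by rewrite lie_anti linear0 oppr0. Qed.

Lemma lie_suml I (r : seq I) (P : pred I) (F : I -> g) y :
  ⁅\sum_(i <- r | P i) F i, y⁆ = \sum_(i <- r | P i) ⁅F i, y⁆.
Proof. by rewrite lie_anti linear_sum -sumrN; apply: eq_bigr => i _; rewrite -lie_anti. Qed.

Lemma lie_deriv x y z : ⁅x, ⁅y, z⁆⁆ = ⁅⁅x, y⁆, z⁆ + ⁅y, ⁅x, z⁆⁆.
Proof.
have /eqP := lie_jacobi x y z; rewrite -addrA addr_eq0 => /eqP ->.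
by rewrite opprD addrC (lie_anti z ⁅x, y⁆) opprK (lie_anti z x) linearN opprK.
Qed.

Lemma adE x y : ad x y = ⁅x, y⁆.
Proof. by rewrite lfunE. Qed.

Definition lfun_tr (u : 'End(g)) : K :=
  \tr (passmx.mxof (vbasis {:g}) (vbasis {:g}) u).

Lemma killingE x y : killing x y = lfun_tr (ad x \o ad y)%VF.
Proof. by []. Qed.

Lemma lfun_tr_linear : linear_for *%R lfun_tr.
Proof.
by move=> c u v; rewrite /lfun_tr passmx.mxof_linear mxtraceD mxtraceZ.
Qed.

HB.instance Definition _ :=
  GRing.isLinear.Build K 'End(g) K *%R lfun_tr lfun_tr_linear.

Lemma lfun_trC (u v : 'End(g)) : lfun_tr (u \o v)%VF = lfun_tr (v \o u)%VF.
Proof.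
by rewrite /lfun_tr !(passmx.mxof_comp _ _ (vbasisP {:g})) mxtrace_mulC.
Qed.

Lemma killingC x y : killing x y = killing y x.
Proof. by rewrite !killingE lfun_trC. Qed.

Lemma ad_linear : linear (@ad K g).
Proof.
move=> c x y; apply/lfunP => z.
by rewrite add_lfunE scale_lfunE !adE lieDl lieZl.
Qed.

HB.instance Definition _ :=
  GRing.isLinear.Build K g 'End(g) *:%R (@ad K g) ad_linear.

Lemma killing_linear x : linear_for *%R (killing x).
Proof.
move=> c y z; rewrite !killingE linearP /= comp_lfunDr -comp_lfunZr.
by rewrite linearD linearZ.
Qed.

HB.instance Definition _ x :=
  GRing.isLinear.Build K g K *%R (killing x) (killing_linear x).

Lemma killingDl x y z : killing (x + y) z = killing x z + killing y z.
Proof. by rewrite killingC linearD /= !(killingC z). Qed.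

Lemma killingZl c x z : killing (c *: x) z = c * killing x z.
Proof. by rewrite killingC linearZ /= (killingC z). Qed.

Lemma ad_lie x y : ad ⁅x, y⁆ = ((ad x \o ad y) - (ad y \o ad x))%VF.
Proof.
apply/lfunP => z.
by rewrite add_lfunE opp_lfunE !comp_lfunE !adE [⁅x, ⁅y, z⁆⁆]lie_deriv addrK.
Qed.

(** The trace of a commutator against a third operator is cyclic. *)
Lemma killing_inv x y z : killing ⁅x, y⁆ z = killing x ⁅y, z⁆.
Proof.
rewrite !killingE !ad_lie.
rewrite comp_lfunDl comp_lfunDr comp_lfunNl comp_lfunNr !linearB /=.
congr (_ - _); first by rewrite comp_lfunA.
by rewrite -comp_lfunA lfun_trC comp_lfunA.
Qed.

End LieBasics.

(** * Eigenvectors and generalized eigenvectors *)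

Section Spectral.
Variables (K : numClosedFieldType) (V : vectType K).
Implicit Types (D f : 'End(V)) (U : {vspace V}) (x y v : V) (a b c : K).

Lemma stable_eigenvector D U :
    U != 0%VS -> (forall x, x \in U -> D x \in U) ->
  exists a, exists2 v, v \in U & v != 0 /\ D v = a *: v.
Proof.
move=> U0 DU; pose DU' : 'End(subvs_of U) := linfun (vsproj U \o D \o vsval).
have bP := vbasisP {: subvs_of U}.
have d0 : (0 < \dim {: subvs_of U})%N.
  by rewrite dimvf lt0n dimv_eq0.
have [a /eigenvalueP[u uM u0]] :=
  eigenvalue_closed (mxof (vbasis fullv) (vbasis fullv) DU') d0.
exists a; exists (vsval (vecof (vbasis {: subvs_of U}) u)); first exact: subvsP.
split.
  apply: contraNneq u0 => v0; rewrite -(vecof_eq0 bP) -(inj_eq val_inj).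
  by rewrite [\val _]v0.
have := hom_vecof (vbasis {: subvs_of U}) bP DU' u.
rewrite uM linearZ /= => /(congr1 vsval).
by rewrite lfunE /= vsprojK ?DU ?subvsP // => ->.
Qed.

(** Each eigenspace of one operator is stable under the operators that commute
    with it, which allows to treat the operators one after the other. *)
Lemma stable_common_eigenvector (fs : seq 'End(V)) U :
    {in fs &, forall f1 f2, (f1 \o f2 = f2 \o f1)%VF} ->
    U != 0%VS -> {in fs, forall f x, x \in U -> f x \in U} ->
  exists2 v, v \in U & v != 0 /\ forall f, f \in fs -> exists a, f v = a *: v.
Proof.
elim: fs U => [|f fs IH] U fC U0 fU.
  by exists (vpick U); rewrite ?memv_pick // vpick0; split.
have fE x : x \in U -> f x \in U by apply: fU; rewrite mem_head.
have [a [v vU [v0 fv]]] := stable_eigenvector U0 fE.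
have memW x : (x \in U :&: lker (f - a *: \1%VF))%VS = (x \in U) && (f x == a *: x).
  by rewrite memv_cap memv_ker add_lfunE opp_lfunE scale_lfunE id_lfunE subr_eq0.
have [] := IH (U :&: lker (f - a *: \1%VF))%VS.
- by move=> f1 f2 h1 h2; apply: fC; rewrite inE ?h1 ?h2 orbT.
- apply: contraNneq v0 => W0; have := memW v.
  by rewrite W0 memv0 vU fv eqxx => ->.
- move=> f1 h1 x; rewrite !memW => /andP[xU /eqP fx].
  rewrite fU ?inE ?h1 ?orbT //=.
  by rewrite -comp_lfunE fC ?inE ?eqxx ?h1 ?orbT // comp_lfunE fx linearZ.
move=> w; rewrite memW => /andP[wU /eqP fw] [w0 wfs].
exists w => //; split => // f1; rewrite inE => /predU1P[->|/wfs//].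
by exists a.
Qed.

(** The zero vector is a generalized eigenvector for every [a]. *)
Definition gen_eigen D a x := exists n, iter n (D - a *: \1%VF) x = 0.

Lemma iter_lfun_linear n D : linear (iter n D).
Proof. by elim: n => [|n IH] c x y //; rewrite !iterS IH linearP. Qed.

HB.instance Definition _ n D :=
  GRing.isLinear.Build K V V *:%R (iter n D) (iter_lfun_linear n D).

Lemma shiftE D a x : (D - a *: \1%VF) x = D x - a *: x.
Proof. by rewrite add_lfunE opp_lfunE scale_lfunE id_lfunE. Qed.

Lemma gen_eigenD D a x y : gen_eigen D a x -> gen_eigen D a y ->
  gen_eigen D a (x + y).
Proof.
move=> [m xm] [n yn]; exists (n + m)%N; rewrite linearD /=.
rewrite iterD xm linear0 add0r.
by rewrite addnC iterD yn linear0.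
Qed.

Lemma gen_eigenZ D a c x : gen_eigen D a x -> gen_eigen D a (c *: x).
Proof. by move=> [m xm]; exists m; rewrite linearZ /= xm scaler0. Qed.

Lemma gen_eigenB D a x y : gen_eigen D a x -> gen_eigen D a y ->
  gen_eigen D a (x - y).
Proof. by move=> hx hy; rewrite -scaleN1r; apply/gen_eigenD/gen_eigenZ. Qed.

Lemma gen_eigenS D a x : gen_eigen D a (D x - a *: x) -> gen_eigen D a x.
Proof. by move=> [m xm]; exists m.+1; rewrite iterSr shiftE. Qed.

(** [D - a] is invertible on the generalized eigenspace of [b]: there it is the
    non-zero scalar [b - a] plus the nilpotent operator [D - b]. *)
Lemma gen_eigen_solve D a b U x : (forall x, x \in U -> D x \in U) ->
    b != a -> x \in U -> gen_eigen D b x ->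
  exists u, [/\ u \in U, gen_eigen D b u & D u - a *: u = x].
Proof.
move=> DU nba + [n]; elim: n x => [|n IH] x xU xn.
  rewrite -[x]/(iter 0 (D - b *: \1%VF) x) xn.
  by exists 0; rewrite mem0v linear0 scaler0 subr0; split=> //; exists 0%N.
have [||u [uU [m um] Du]] := IH (D x - b *: x) _ _.
- by rewrite memvB ?memvZ ?DU.
- by rewrite -shiftE -iterSr.
exists ((b - a)^-1 *: (x - u)); split.
- by rewrite memvZ ?memvB.
- by apply: gen_eigenZ; apply: gen_eigenB; [exists n.+1 | exists m].
rewrite linearZ linearB /= scalerA mulrC -scalerA -scalerBr.
have -> : D x - D u - a *: (x - u) = (b - a) *: x.
  have -> : D x - D u - a *: (x - u) = (D x - a *: x) - (D u - a *: u).
    by rewrite -linearB -!shiftE linearB.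
  by rewrite Du opprB addrC subrKA scalerBl.
by rewrite scalerA mulVf ?scale1r // subr_eq0.
Qed.

(** Membership in the sum of the generalized eigenspaces of [D] inside [U]; as an
    inductive predicate it needs no list of the eigenvalues. *)
Inductive sum_gen_eigen D U : V -> Prop :=
| sum_gen_eigen1 a x : x \in U -> gen_eigen D a x -> sum_gen_eigen D U x
| sum_gen_eigenD x y :
    sum_gen_eigen D U x -> sum_gen_eigen D U y -> sum_gen_eigen D U (x + y).

(** By induction on [dim U]: if [a] is an eigenvalue of [D] on [U], the stable
    space [(D - a) U] is smaller, so [(D - a) x] is a sum of generalized
    eigenvectors. Those of eigenvalue different from [a] lift through [D - a]; once
    these lifts are subtracted from [x], the rest is a generalized eigenvector for
    [a]. *)
Lemma gen_eigen_decomposition D U x : (forall x, x \in U -> D x \in U) ->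
  x \in U -> sum_gen_eigen D U x.
Proof.
have [n] := ubnP (\dim U); elim: n U x => // n IH U x Un DU xU.
have [U0|U0] := eqVneq U 0%VS.
  apply: (@sum_gen_eigen1 _ _ 0) => //; exists 0%N.
  by move: xU; rewrite U0 memv0 => /eqP.
have [a [v vU [v0 Dv]]] := stable_eigenvector U0 DU.
pose W := ((D - a *: \1%VF) @: U)%VS.
have WU : (W <= U)%VS.
  by apply/subvP => _ /memv_imgP[y yU ->]; rewrite shiftE memvB ?memvZ ?DU.
have DW y : y \in W -> D y \in W.
  case/memv_imgP=> z zU ->; apply/memv_imgP; exists (D z); rewrite ?DU //.
  by rewrite !shiftE linearB linearZ.
have Wn : (\dim W < n)%N.
  rewrite -ltnS (leq_trans _ Un) // ltnS -(limg_ker_dim (D - a *: \1%VF) U).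
  rewrite -[X in (X < _)%N]add0n ltn_add2r lt0n dimv_eq0.
  apply: contraNneq v0 => k0; rewrite -memv0 -k0 memv_cap vU memv_ker shiftE Dv.
  by rewrite subrr eqxx.
have corr y : sum_gen_eigen D W y ->
    exists u, [/\ u \in U, sum_gen_eigen D U u & gen_eigen D a (D u - a *: u - y)].
  elim=> [b z zW zb|z1 z2 _ [u1 [u1U u1s u1a]] _ [u2 [u2U u2s u2a]]].
    have [ba|nba] := eqVneq b a.
      exists 0; rewrite mem0v linear0 scaler0 subr0 sub0r; split => //.
        by apply: (@sum_gen_eigen1 _ _ 0); rewrite ?mem0v //; exists 0%N.
      by rewrite -scaleN1r; apply: gen_eigenZ; rewrite -ba.
    have [u [uU ub uz]] := gen_eigen_solve DU nba (subvP WU _ zW) zb.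
    exists u; rewrite uz subrr; split => //; first exact: sum_gen_eigen1 ub.
    by exists 0%N.
  exists (u1 + u2); split; [exact: memvD | exact: sum_gen_eigenD |].
  rewrite linearD /= scalerDr.
  have -> : D u1 + D u2 - (a *: u1 + a *: u2) - (z1 + z2) =
            D u1 - a *: u1 - z1 + (D u2 - a *: u2 - z2).
    by rewrite !opprD [RHS]addrACA; congr (_ + _); rewrite [RHS]addrACA.
  exact: gen_eigenD.
have [|u [uU us ua]] := corr (D x - a *: x).
  by apply: IH => //; rewrite -shiftE memv_img.
rewrite -(subrK u x); apply: sum_gen_eigenD => //.
apply: (@sum_gen_eigen1 _ _ a); first exact: memvB.
apply: gen_eigenS.
have -> : D (x - u) - a *: (x - u) = - (D u - a *: u - (D x - a *: x)).
  by rewrite -!shiftE linearB opprB.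
by rewrite -scaleN1r; apply: gen_eigenZ.
Qed.

Lemma finite_spectrum D :
  exists s : seq K, forall a v, v != 0 -> D v = a *: v -> a \in s.
Proof.
have bP := vbasisP {:V}; set M := mxof (vbasis {:V}) (vbasis {:V}) D.
have [s sE] := closed_field_poly_normal (char_poly M).
exists s => a v v0 Dv; have : eigenvalue M a.
  apply/eigenvalueP; exists (rVof (vbasis {:V}) v).
    by rewrite -rVof_app // Dv linearZ.
  by rewrite rVof_eq0.
rewrite eigenvalue_root_char sE (monicP (char_poly_monic M)) scale1r.
by rewrite root_prod_XsubC.
Qed.

Lemma gen_eigen_eigen D a x : x != 0 -> gen_eigen D a x ->
  exists2 v, v != 0 & D v = a *: v.
Proof.
move=> + [n]; elim: n x => [|n IH] x x0 xn; first by rewrite -xn eqxx in x0.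
have [Dx|Dx] := eqVneq (D x) (a *: x); first by exists x.
apply: (IH (D x - a *: x)); rewrite ?subr_eq0 //.
by rewrite -shiftE -iterSr.
Qed.

(** The iterates of [f] move a generalized eigenvector through the pairwise
    distinct eigenvalues [b, b + a, b + 2a, ...], of which only finitely many are
    available. *)
Lemma gen_eigen_shift_nilpotent D f a : a != 0 ->
    (forall b v, gen_eigen D b v -> gen_eigen D (b + a) (f v)) ->
  exists N, forall v, iter N f v = 0.
Proof.
move=> a0 fD; have [s sP] := finite_spectrum D.
exists (size s) => v.
have: sum_gen_eigen D fullv v.
  by apply: gen_eigen_decomposition => [x _|]; rewrite memvf.
elim=> [b x _ xb|x y _ hx _ hy]; last by rewrite linearD /= hx hy addr0.
have iterb M : gen_eigen D (b + a *+ M) (iter M f x).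
  by elim: M => [|M IH]; rewrite ?addr0 //= mulrSr addrA; apply: fD.
have : ~~ all (mem s) [seq b + a *+ M | M <- iota 0 (size s).+1].
  apply/negP => /allP sub.
  have us : uniq [seq b + a *+ M | M <- iota 0 (size s).+1].
    rewrite map_inj_uniq ?iota_uniq // => m n /addrI /eqP.
    by rewrite -!(mulr_natr a) (inj_eq (mulfI a0)) eqr_nat => /eqP.
  by have := uniq_leq_size us sub; rewrite size_map size_iota ltnn.
case/allPn=> _ /mapP[M + ->] /=; rewrite mem_iota add0n ltnS => /andP[_ Ms] Mn.
have fM0 : iter M f x = 0.
  apply/eqP; apply: contraNT Mn => n0.
  have [w w0 Dw] := gen_eigen_eigen n0 (iterb M).
  exact: sP w0 Dw.
by rewrite -(subnK Ms) iterD fM0 linear0.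
Qed.

End Spectral.

(** * Trace of the square of a matrix with real eigenvalues *)

Section TraceSquare.
Variables (K : numClosedFieldType) (n : nat).

(** In triangular form the trace of the square is the sum of the squares of the
    eigenvalues. *)
Lemma mxtrace_sqr_real (M : 'M[K]_n) :
    (forall a, eigenvalue M a -> a \is Num.real) ->
  0 <= \tr (M *m M) /\
  (\tr (M *m M) = 0 -> forall a, eigenvalue M a -> a = 0).
Proof.
case: n M => [|m] M Mreal.
  rewrite [M *m M]thinmx0 mxtrace0; split => // _ a /eigenvalueP[v _].
  by rewrite (thinmx0 v) eqxx.
have [P /unitarymx_unit Pu Ttrig] := Schur M (ltn0Sn m).
set T := conjmx P M in Ttrig; rewrite /simmx_to_for in Ttrig.
have Tu : row_free P by rewrite row_free_unit.
have MT : M = invmx P *m T *m P by rewrite -conjVmx // conjmxK.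
have diag i : eigenvalue M (T i i).
  apply: (@eigenvalue_conjmx _ _ _ P) => //; first exact: stablemx_unit.
  rewrite [_ \in _]eigenvalue_root_char char_poly_trig //.
  by rewrite rootE horner_prod (bigD1 i) //= hornerXsubC subrr mul0r.
have MTeig a : eigenvalue M a -> eigenvalue T a.
  rewrite MT -conjVmx // => /eigenvalue_conjmx.
  by rewrite stablemx_unit ?row_free_unit ?unitmx_inv // => /(_ isT Pu).
have {}Ttrig : is_trig_mx T by [].
clearbody T.
have trE : \tr (M *m M) = \sum_i T i i ^+ 2.
  have -> : M *m M = invmx P *m (T *m T *m P).
    by rewrite {1}MT {1}MT !mulmxA mulmxK.
  rewrite mxtrace_mulC mulmxK //.
  apply: eq_bigr => i _; rewrite mxE (bigD1 i) //= big1 ?addr0 ?expr2 // => j.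
  rewrite -val_eqE neq_ltn => /orP[] ij.
    by rewrite (is_trig_mxP Ttrig _ _ ij) mulr0.
  by rewrite (is_trig_mxP Ttrig _ _ ij) mul0r.
have ge0 i : 0 <= T i i ^+ 2 by rewrite real_exprn_even_ge0 // Mreal.
split; first by rewrite trE sumr_ge0.
rewrite trE => /eqP; rewrite psumr_eq0 // => /allP T0 a /MTeig.
rewrite eigenvalue_root_char char_poly_trig //.
rewrite rootE horner_prod => /prodf_eq0[i _].
rewrite hornerXsubC subr_eq0 => /eqP ->.
by have := T0 i (mem_index_enum i); rewrite sqrf_eq0 => /eqP.
Qed.

End TraceSquare.

(** * Engel's theorem *)

Section Engel.
Variables (K : fieldType) (g : lieAlgType K).
Implicit Types (x y v w : g) (T : seq g) (U V W : {vspace g}).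

Lemma lie_prodP U V W :
  (lie_prod U V <= W)%VS <-> forall x y, x \in U -> y \in V -> ⁅x, y⁆ \in W.
Proof.
split=> [/subvP sub x y xU yV|sub]; last first.
  apply/span_subvP => _ /allpairsP[[x y] [/= xU yV ->]].
  by apply: sub; apply: vbasis_mem.
apply: sub; rewrite (coord_vbasis xU) (coord_vbasis yV) lie_suml.
apply: memv_suml => i _; rewrite lieZl linear_sum memvZ //.
apply: memv_suml => j _; rewrite linearZ memvZ //=.
by apply/memv_span/allpairsP; exists ((vbasis U)`_i, (vbasis V)`_j);
  rewrite /= !mem_nth ?size_tuple.
Qed.

(** Every condition below is imposed on a spanning list and extended to its span
    by this lemma. *)
Lemma span_lie T W x v : (forall t, t \in T -> ⁅t, v⁆ \in W) ->
  x \in <<T>>%VS -> ⁅x, v⁆ \in W.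
Proof.
move=> TW; have sub : (<<T>> <= ad v @^-1: W)%VS.
  by apply/span_subvP => t tT; rewrite -memv_preim adE lie_anti memvN TW.
by move=> /(subvP sub); rewrite -memv_preim adE lie_anti memvN.
Qed.

Definition lie_stable T W := forall t w, t \in T -> w \in W -> ⁅t, w⁆ \in W.

(** The conclusion of Engel's theorem for [T], required of every pair of stable
    subspaces so that it applies to subquotients of [g]. *)
Definition engel_property T := forall V W,
  lie_stable T V -> lie_stable T W -> (W <= V)%VS -> W != V ->
  exists2 v, v \in V & v \notin W /\ forall t, t \in T -> ⁅t, v⁆ \in W.

Variable S : set g.
Hypothesis S_lie : forall x y, S x -> S y -> S ⁅x, y⁆.
Hypothesis S_nil : forall x, S x -> exists N, forall v, iter N (ad x) v = 0.

(** Choose [W] maximal among the [T]-stable spaces that contain [<<T>>] but no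
    element of [S] outside [<<T>>]. It is not all of [g], so the property of [T]
    enlarges it by a vector that [T] sends into [W]. By maximality the larger space
    contains some [s] of [S] outside [<<T>>], and the brackets of [T] with [s] are
    elements of [S] inside [W], hence in [<<T>>]. *)
Lemma engel_normalizer T : {in T, forall t, S t} ->
    {in T &, forall t1 t2, ⁅t1, t2⁆ \in <<T>>%VS} -> engel_property T ->
    ~ (forall s, S s -> s \in <<T>>%VS) ->
  exists s, [/\ S s, s \notin <<T>>%VS & forall t, t \in T -> ⁅t, s⁆ \in <<T>>%VS].
Proof.
move=> TS Tlie TE nST.
have [//|nex] := pselect (exists s, [/\ S s, s \notin <<T>>%VS &
                        forall t, t \in T -> ⁅t, s⁆ \in <<T>>%VS]).
suff [W [_ _]] : exists W, [/\ lie_stable T W, (<<T>> <= W)%VS /\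
    forall s, S s -> s \in W -> s \in <<T>>%VS & (\dim {:g} < \dim W)%N].
  by rewrite ltnNge dimvS // subvf.
elim: (\dim {:g}).+1 => [|m [W [stW [TW SW] mW]]].
  exists <<T>>%VS; split=> // t w tT; rewrite lie_anti memvN.
  by apply: span_lie => t' t'T; apply: Tlie.
have nW : W != fullv.
  by apply: contra_not_neq nST => W1 s Ss; apply: SW; rewrite // W1 memvf.
have [//|v _ [vW vT]] := TE fullv W _ stW (subvf W) nW.
  by move=> *; rewrite memvf.
have memW' t w : t \in T -> w \in (W + <[v]>)%VS -> ⁅t, w⁆ \in W.
  move=> tT /memv_addP[w1 w1W [w2 /vlineP[c ->] ->]].
  by rewrite linearD linearZ /= memvD ?memvZ ?vT ?stW.
exists (W + <[v]>)%VS; split; last 1 first.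
- rewrite (leq_ltn_trans mW) // ltn_neqAle dimvS ?addvSl // andbT.
  apply: contra vW; rewrite (dimv_leqif_eq (addvSl W <[v]>)) => /eqP ->.
  by rewrite (subvP (addvSr _ _)) ?memv_line.
- by move=> t w tT wW'; apply/(subvP (addvSl _ _))/memW'.
split; first exact: subv_trans (addvSl _ _).
move=> s Ss sW'; apply: contrapT => /negP sT; apply: nex; exists s; split => // t tT.
by apply: SW; [apply: S_lie => //; apply: TS | apply: memW'].
Qed.

(** As [s] normalizes [<<T>>], it preserves the space of vectors of [V] sent into
    [W] by [T]; the last iterate of [s] on such a vector that is still outside [W]
    is sent into [W] by [s] as well. *)
Lemma engel_extend T s : engel_property T ->
    S s -> (forall t, t \in T -> ⁅t, s⁆ \in <<T>>%VS) ->
  engel_property (s :: T).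
Proof.
move=> TE Ss sT V W stV stW WV nWV.
have [||v vV [vW vT]] := TE V W _ _ WV nWV.
- by move=> t w tT; apply: stV; rewrite inE tT orbT.
- by move=> t w tT; apply: stW; rewrite inE tT orbT.
pose u n := iter n (ad s) v.
have uV n : u n \in V.
  by elim: n => // n IH; rewrite /u iterS adE stV ?mem_head.
have uT n t : t \in T -> ⁅t, u n⁆ \in W.
  elim: n t => [|n IH] t tT; first exact: vT.
  rewrite /u iterS adE lie_deriv memvD //.
    by apply: span_lie (sT t tT) => t' /IH.
  by apply: stW; rewrite ?mem_head // IH.
have [N NP] := S_nil Ss.
have exW : exists n, u n \in W by exists N; rewrite /u NP mem0v.
case: (ex_minnP exW) => [[|n] unW minn]; first by rewrite unW in vW.
exists (u n) => //; split.
  by apply/negP => /minn; rewrite ltnn.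
move=> t; rewrite inE => /predU1P[->|]; last exact: uT.
by rewrite -adE.
Qed.

(** Sums of elements of [S] need not be nilpotent a priori: [S] can be the set of
    homogeneous elements of a graded algebra, which is why it is only required to
    be closed under bracket. A list [T] of elements of [S] with the required
    property is enlarged until it spans [S]; the dimension of [g] bounds the number
    of steps. *)
Lemma engel V W :
    (forall x v, S x -> v \in V -> ⁅x, v⁆ \in V) ->
    (forall x v, S x -> v \in W -> ⁅x, v⁆ \in W) -> (W <= V)%VS -> W != V ->
  exists2 v, v \in V & v \notin W /\ forall x, S x -> ⁅x, v⁆ \in W.
Proof.
move=> stV stW WV nWV.
have [T [TS Tlie TE ST]] : exists T, [/\ {in T, forall t, S t},
    {in T &, forall t1 t2, ⁅t1, t2⁆ \in <<T>>%VS}, engel_property T &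
    forall s, S s -> s \in <<T>>%VS].
  suff [T [TS Tlie TE [ST|Td]]] : exists T, [/\ {in T, forall t, S t},
      {in T &, forall t1 t2, ⁅t1, t2⁆ \in <<T>>%VS}, engel_property T &
      (forall s, S s -> s \in <<T>>%VS) \/ (\dim {:g} < \dim <<T>>)%N].
  - by exists T.
  - by move: Td; rewrite ltnNge dimvS // subvf.
  elim: (\dim {:g}).+1 => [|m [T [TS Tlie TE Tm]]].
    exists [::]; split=> //; last by right.
    move=> V0 W0 _ _ WV0 nWV0.
    have /subvPn[v vV vW] : ~~ (V0 <= W0)%VS.
      by apply: contra nWV0 => VW0; rewrite eqEsubv WV0.
    by exists v.
  have [ST|nST] := pselect (forall s, S s -> s \in <<T>>%VS).
    by exists T; split=> //; left.
  case: Tm => // Tm.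
  have [s [Ss sT Ts]] := engel_normalizer TS Tlie TE nST.
  have sub : (<<T>> <= <<s :: T>>)%VS by rewrite span_cons addvSr.
  exists (s :: T); split.
  - by move=> t; rewrite inE => /predU1P[->|/TS].
  - move=> t1 t2; rewrite !inE => /predU1P[->|t1T] /predU1P[->|t2T].
    + by rewrite lie_alt mem0v.
    + by rewrite lie_anti memvN (subvP sub) ?Ts.
    + by rewrite (subvP sub) ?Ts.
    + by rewrite (subvP sub) ?Tlie.
  - exact: engel_extend.
  right; rewrite (leq_ltn_trans Tm) // ltn_neqAle dimvS // andbT.
  apply: contra sT; rewrite (dimv_leqif_eq sub) => /eqP ->.
  by rewrite memv_span ?mem_head.
have [||v vV [vW vT]] := TE V W _ _ WV nWV.
- by move=> t w /TS; apply: stV.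
- by move=> t w /TS; apply: stW.
by exists v => //; split => // x /ST; apply: span_lie.
Qed.

End Engel.

(** * Cartan subalgebras and roots *)

(** [ad d] being a derivation, [ad d - (a + b)] acts on [[x,y]] as
    [ad d - a] on [x] plus [ad d - b] on [y]. *)
Lemma gen_eigen_lie (K : numClosedFieldType) (g : lieAlgType K) (d x y : g) (a b : K) :
  gen_eigen (ad d) a x -> gen_eigen (ad d) b y -> gen_eigen (ad d) (a + b) ⁅x, y⁆.
Proof.
move=> [m xm] [n yn]; have [N] := ubnP (m + n).
elim: N m n x y xm yn => // N IH [|m] n x y xm yn.
  by move: xm => /= ->; rewrite lie0l; exists 0%N.
case: n yn => [|n] yn; first by move: yn => /= ->; rewrite linear0; exists 0%N.
rewrite addSn ltnS => mnN; apply: gen_eigenS.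
have -> : ad d ⁅x, y⁆ - (a + b) *: ⁅x, y⁆ =
          ⁅ad d x - a *: x, y⁆ + ⁅x, ad d y - b *: y⁆.
  have -> : ⁅x, ad d y - b *: y⁆ = ⁅x, ⁅d, y⁆⁆ - b *: ⁅x, y⁆.
    by rewrite linearB linearZ adE.
  by rewrite lieDl lieNl lieZl !adE lie_deriv scalerDl opprD addrACA.
apply: gen_eigenD.
  by apply: (IH m n.+1) => //; rewrite -shiftE -iterSr.
by apply: (IH m.+1 n); rewrite ?addSnnS // -shiftE -iterSr.
Qed.

Section Cartan.
Variables (K : numClosedFieldType) (g : lieAlgType K).
Variables (H : {vspace g}) (Pi : seq 'Hom(subvs_of H, K^o)).
Hypothesis H_cartan : cartan_subalgebra H.
Hypothesis Pi_simple : simple_roots Pi.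
Implicit Types (t u : subvs_of H) (x y v : g) (alpha : 'Hom(subvs_of H, K^o)).

Lemma simple_roots_separate t : (forall alpha, alpha \in Pi -> alpha t = 0) -> t = 0.
Proof.
have [Pi_basis _ _] := Pi_simple => t0.
have all0 alpha : alpha t = 0.
  have aP : alpha \in <<in_tuple Pi>>%VS by rewrite (span_basis Pi_basis) memvf.
  rewrite (coord_span aP) sum_lfunE big1 // => i _.
  by rewrite scale_lfunE t0 ?scaler0 // mem_nth.
rewrite (coord_vbasis (memvf t)) big1 // => i _.
have := all0 (linfun (coord (vbasis {:subvs_of H}) i : _ -> K^o)).
by rewrite lfunE /= => ->; rewrite scale0r.
Qed.

(** The simple roots separate the points of [H], and there are [dim H] of them. *)
Lemma simple_roots_interpolate (c : 'I_(size Pi) -> K) :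
  exists t, forall i : 'I_(size Pi), Pi`_i t = c i.
Proof.
have [Pi_basis _ _] := Pi_simple.
pose ev0 t := \row_(i < size Pi) (Pi`_i t : K).
have ev0_lin : linear ev0.
  by move=> a t u; apply/rowP => i; rewrite !mxE linearP.
pose ev : {linear subvs_of H -> 'rV[K]_(size Pi)} :=
  HB.pack ev0 (GRing.isLinear.Build _ _ _ _ ev0 ev0_lin).
have evE t (i : 'I_(size Pi)) : linfun ev t 0 i = Pi`_i t by rewrite lfunE mxE.
have ker0 : lker (linfun ev) == 0%VS.
  apply/lker0P/raddf_inj => t /rowP evt; apply: simple_roots_separate => alpha.
  move=> /(nthP 0)[i iPi <-].
  by have := evt (Ordinal iPi); rewrite evE mxE.
have szPi : size Pi = \dim {:subvs_of H}.
  have /esym := @vector.size_basis _ _ _ _ (in_tuple Pi) Pi_basis.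
  by rewrite dimvf /dim /= muln1 dimvf => ->.
have im : limg (linfun ev) = fullv.
  apply/eqP; rewrite eqEdim subvf limg_dim_eq ?(eqP ker0) ?capv0 //.
  by rewrite -szPi dimvf /dim /= mul1n.
have /memv_imgP[t _ tc] : \row_i c i \in limg (linfun ev) by rewrite im memvf.
by exists t => i; rewrite -evE -tc mxE.
Qed.

(** Roots vanish on brackets, because they have genuine eigenvectors. *)
Lemma cartan_abelian x y : x \in H -> y \in H -> ⁅x, y⁆ = 0.
Proof.
have [Pi_basis Pi_roots _] := Pi_simple; have [subH _ _] := H_cartan.
move=> xH yH; have xyH : ⁅x, y⁆ \in H by apply: (lie_prodP _ _ _).1 subH _ _ xH yH.
rewrite -(vsprojK xyH); suff -> : vsproj H ⁅x, y⁆ = 0 by [].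
apply: simple_roots_separate => alpha /Pi_roots[_ [v v0 rv]].
apply/eqP; have /eqP : (alpha (vsproj H ⁅x, y⁆) : K) *: v = 0.
  rewrite -rv vsprojK //.
  have := lie_deriv x y v; have := rv (vsproj H x); have := rv (vsproj H y).
  rewrite !vsprojK // => yv xv; rewrite yv xv !linearZ /= xv yv scalerA mulrC -scalerA.
  by move=> /esym/eqP; rewrite -subr_eq0 addrK => /eqP.
by rewrite scaler_eq0 (negPf v0) orbF.
Qed.

Lemma root_value alpha : is_root alpha ->
  exists b : bool, exists c : 'I_(size Pi) -> nat,
    forall t, (alpha t : K) = (-1) ^+ b * (\sum_(i < size Pi) (Pi`_i t : K) *+ c i).
Proof.
have [_ _ Pi_gen] := Pi_simple => /Pi_gen[c cP].
have sumE t : ((\sum_(i < size Pi) Pi`_i *+ c i) t : K) =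
    \sum_(i < size Pi) (Pi`_i t : K) *+ c i.
  rewrite sum_lfunE; apply: eq_bigr => i _.
  by rewrite -(scaler_nat (c i) Pi`_i) scale_lfunE scaler_nat.
case: cP => ->; [exists false | exists true]; exists c => t.
  by rewrite mul1r sumE.
by rewrite opp_lfunE sumE mulN1r.
Qed.

Definition weight_vector alpha v := forall t, ⁅vsval t, v⁆ = (alpha t : K) *: v.

Lemma stable_weight_vector (U : {vspace g}) :
    U != 0%VS -> (forall x v, x \in H -> v \in U -> ⁅x, v⁆ \in U) ->
  exists2 v, v \in U & v != 0 /\ exists alpha, weight_vector alpha v.
Proof.
move=> U0 HU.
have [||v vU [v0 veig]] := @stable_common_eigenvector _ _ [seq ad x | x <- vbasis H] U _ U0.
- move=> _ _ /mapP[x xH ->] /mapP[y yH ->]; apply/lfunP => w.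
  apply/eqP; rewrite -subr_eq0 -opp_lfunE -add_lfunE -ad_lie adE.
  by rewrite (cartan_abelian (vbasis_mem xH) (vbasis_mem yH)) lie0l.
- by move=> _ /mapP[x xH ->] w wU; rewrite adE HU // (vbasis_mem xH).
exists v => //; split => //.
have Hv : (H <= ad v @^-1: <[v]>)%VS.
  rewrite -(span_basis (vbasisP H)); apply/span_subvP => x xH.
  have [a xv] := veig (ad x) (map_f _ xH).
  by rewrite -memv_preim adE lie_anti memvN -adE xv memvZ ?memv_line.
pose al := linfun (coord [tuple v] 0 \o (- ad v)%VF \o vsval : subvs_of H -> K^o).
exists al => t; rewrite lfunE /= opp_lfunE adE -lie_anti.
have : ⁅vsval t, v⁆ \in <<[tuple v]>>%VS.
  rewrite span_seq1 lie_anti memvN -adE memv_preim; apply: (subvP Hv).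
  exact: subvsP.
by move/coord_span => {1}->; rewrite big_ord1.
Qed.

(** An eigenspace of [ad t] is stable under [H], which is abelian. *)
Lemma eigenvalue_is_weight (U : {vspace g}) t a v :
    (forall x w, x \in H -> w \in U -> ⁅x, w⁆ \in U) ->
    v \in U -> v != 0 -> ⁅vsval t, v⁆ = a *: v ->
  exists2 w, w \in U & w != 0 /\ exists2 alpha, weight_vector alpha w & (alpha t : K) = a.
Proof.
move=> HU vU v0 tv.
have memW w : (w \in U :&: lker (ad (vsval t) - a *: \1%VF))%VS =
              (w \in U) && (⁅vsval t, w⁆ == a *: w).
  by rewrite memv_cap memv_ker shiftE adE subr_eq0.
have [||w] := @stable_weight_vector (U :&: lker (ad (vsval t) - a *: \1%VF))%VS.
- by apply: contraNneq v0 => W0; rewrite -memv0 -W0 memW vU tv eqxx.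
- move=> x w xH; rewrite !memW => /andP[wU /eqP tw].
  rewrite HU //= lie_deriv tw (cartan_abelian (subvsP t) xH) lie0l add0r linearZ.
  by rewrite eqxx.
rewrite memW => /andP[wU /eqP tw] [w0 [alpha walpha]].
exists w => //; split => //; exists alpha => //.
have /eqP : ((alpha t : K) - a) *: w = 0 by rewrite scalerBl -walpha tw subrr.
by rewrite scaler_eq0 (negPf w0) orbF subr_eq0 => /eqP.
Qed.

Lemma weight_root alpha v : v != 0 -> weight_vector alpha v ->
  alpha != 0 -> is_root alpha.
Proof. by move=> v0 va a0; split => //; exists v. Qed.

(** A vector killed by [H] normalizes [H]. *)
Lemma zero_weight_cartan v : weight_vector 0 v -> v \in H.
Proof.
have [_ _ selfN] := H_cartan => v0; apply: selfN => y yH.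
have := v0 (vsproj H y); rewrite vsprojK // zero_lfunE scale0r (lie_anti v) => ->.
by rewrite oppr0 mem0v.
Qed.

Lemma cartan_eigenvalue_int (h v : g) (a : K) : h \in H ->
    (forall alpha, alpha \in Pi -> alpha (vsproj H h) \in [:: 0; 1; 2]) ->
    v != 0 -> ⁅h, v⁆ = a *: v ->
  exists z : int, a = z%:~R.
Proof.
move=> hH Pi_h v0 hv.
have st x w : x \in H -> w \in fullv -> ⁅x, w⁆ \in (fullv : {vspace g}).
  by rewrite !memvf.
have hv' : ⁅vsval (vsproj H h), v⁆ = a *: v by rewrite vsprojK.
have [w _ [w0 [alpha wa <-]]] := eigenvalue_is_weight st (memvf v) v0 hv'.
have [->|a0] := eqVneq alpha 0; first by exists 0; rewrite zero_lfunE.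
have [b [c ->]] := root_value (weight_root w0 wa a0).
have [z ->] : exists z : int, \sum_(i < size Pi) (Pi`_i (vsproj H h) : K) *+ c i = z%:~R.
  apply: (big_ind (fun s => exists z : int, s = z%:~R)) => [|_ _ [x ->] [y ->]|i _].
  - by exists 0.
  - by exists (x + y); rewrite intrD.
  have : (Pi`_i (vsproj H h) : K) \in [:: 0; 1; 2] by apply: Pi_h; rewrite mem_nth.
  rewrite !inE => /or3P[] /eqP ->.
  - by exists 0; rewrite mul0rn.
  - by exists (c i)%:Z.
  - by exists (2 * c i)%:Z; rewrite -mulrnA.
by exists ((-1) ^+ b * z); rewrite intrM rmorphXn rmorphN1.
Qed.

(** The eigenvalues of [ad t] are values of roots at [t], hence real, and the value
    of the form at [(t, t)] is the trace of the square of [ad t]. *)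
Lemma killing_real_ge0 t : (forall i : 'I_(size Pi), (Pi`_i t : K) \is Num.real) ->
  0 <= killing (vsval t) (vsval t) /\ (killing (vsval t) (vsval t) = 0 -> t = 0).
Proof.
have [_ Pi_roots _] := Pi_simple => t_real.
have bP := vbasisP {:g}; set M := mxof (vbasis {:g}) (vbasis {:g}) (ad (vsval t)).
have killM : killing (vsval t) (vsval t) = \tr (M *m M).
  by rewrite killingE /lfun_tr (mxof_comp _ _ bP).
have M_real a : eigenvalue M a -> a \is Num.real.
  case/eigenvalueP=> u uM u0.
  have [||||w _ [w0 [alpha wa <-]]] :=
      @eigenvalue_is_weight fullv t a (vecof (vbasis {:g}) u).
  - by move=> *; rewrite memvf.
  - exact: memvf.
  - by rewrite (vecof_eq0 bP).
  - by rewrite -adE (hom_vecof _ bP) uM linearZ.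
  have [->|a0] := eqVneq alpha 0; first by rewrite zero_lfunE real0.
  have [b [c ->]] := root_value (weight_root w0 wa a0).
  by rewrite rpredMsign rpred_sum // => i _; rewrite rpredMn // t_real.
have [M_ge0 M_eq0] := mxtrace_sqr_real M_real.
rewrite killM; split=> // /M_eq0 eig0; apply: simple_roots_separate => alpha.
move=> /Pi_roots[_ [v v0 rv]]; apply: eig0; apply/eigenvalueP.
exists (rVof (vbasis {:g}) v); last by rewrite (rVof_eq0 bP).
by rewrite -(rVof_app _ bP) adE rv linearZ.
Qed.

End Cartan.

(** * Non-degeneracy of the Killing form *)

Section Nondegenerate.
Variables (K : numClosedFieldType) (g : lieAlgType K).
Hypothesis g_semisimple : lie_semisimple g.
Variables (H : {vspace g}) (Pi : seq 'Hom(subvs_of H, K^o)).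
Hypothesis H_cartan : cartan_subalgebra H.
Hypothesis Pi_simple : simple_roots Pi.

Section Ideal.
Variable I : {vspace g}.
Hypothesis I_ideal : is_ideal I.
Hypothesis I_killing : forall x, x \in I -> forall y, killing x y = 0.

Let idealE x y : y \in I -> ⁅x, y⁆ \in I.
Proof. by move=> yI; apply: (lie_prodP _ _ _).1 I_ideal _ _ (memvf x) yI. Qed.

(** Pair [a + ib] with [a - ib], where [a] and [b] are given by the real and
    imaginary parts of the values of the simple roots. *)
Lemma isotropic_ideal_cap_cartan x : x \in I -> x \in H -> x = 0.
Proof.
move=> xI xH; set t := vsproj H x.
have [a aP] := simple_roots_interpolate Pi_simple (fun i => 'Re (Pi`_i t : K)).
have [b bP] := simple_roots_interpolate Pi_simple (fun i => 'Im (Pi`_i t : K)).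
have tE : t = a + 'i *: b.
  apply/eqP; rewrite -subr_eq0; apply/eqP/(simple_roots_separate Pi_simple) => alpha.
  move=> /(nthP 0)[i iPi <-]; rewrite linearB linearD linearZ /=.
  have := aP (Ordinal iPi); have := bP (Ordinal iPi); rewrite /= => -> ->.
  by rewrite [X in X - _]Crect subrr.
have a_real (i : 'I_(size Pi)) : (Pi`_i a : K) \is Num.real by rewrite aP Creal_Re.
have b_real (i : 'I_(size Pi)) : (Pi`_i b : K) \is Num.real by rewrite bP Creal_Im.
have [a_ge0 a_eq0] := killing_real_ge0 H_cartan Pi_simple a_real.
have [b_ge0 b_eq0] := killing_real_ge0 H_cartan Pi_simple b_real.
have := I_killing xI (vsval a - 'i *: vsval b).
have kB u : killing u (vsval a - 'i *: vsval b) =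
            killing u (vsval a) - 'i * killing u (vsval b).
  by rewrite linearB /= [killing u ('i *: _)]linearZ.
have tv : vsval t = vsval a + 'i *: vsval b by rewrite tE linearD linearZ.
rewrite -(vsprojK xH) -/t tv killingDl killingZl !kB (killingC (vsval b) (vsval a)) mulrBr.
rewrite mulrA -expr2 sqrCi mulN1r opprK addrA subrK => /eqP.
rewrite paddr_eq0 // => /andP[/eqP /a_eq0 -> /eqP /b_eq0 ->].
by rewrite linear0 scaler0 addr0.
Qed.

(** Otherwise [H] has a weight vector in [I] whose weight vanishes at [t]. A root
    is a combination of simple roots with coefficients of one sign, so it does not
    vanish there; and a vector of weight zero lies in [H]. *)
Lemma lie_isotropic_regular t x :
    (forall i : 'I_(size Pi), (Pi`_i t : K) = 1) ->
  x \in I -> ⁅vsval t, x⁆ = 0 -> x = 0.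
Proof.
move=> t1 xI tx; apply/eqP/negPn/negP => x0.
have stI y w : y \in H -> w \in I -> ⁅y, w⁆ \in I by move=> _; apply: idealE.
have tx0 : ⁅vsval t, x⁆ = 0 *: x by rewrite scale0r.
have [w wI [w0 [alpha wa at0]]] := eigenvalue_is_weight H_cartan Pi_simple stI xI x0 tx0.
have [a0|a0] := eqVneq alpha 0.
  move: w0; rewrite (isotropic_ideal_cap_cartan wI) ?eqxx //.
  by apply: (zero_weight_cartan H_cartan); rewrite -a0.
have aroot := weight_root w0 wa a0.
have [b [c ac]] := root_value Pi_simple aroot.
have sum0 : \sum_(i < size Pi) (1 : K) *+ c i = 0.
  have /eqP := ac t; rewrite at0 eq_sym mulf_eq0 signr_eq0 /= => /eqP s0.
  by rewrite -[RHS]s0; apply: eq_bigr => i _; rewrite t1.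
have c0 i : c i = 0%N.
  move/eqP: sum0; rewrite psumr_eq0 => [/allP/(_ i (mem_index_enum i))|j _].
    by rewrite /= pnatr_eq0 => /eqP.
  by rewrite ler0n.
case/eqP: a0; apply/lfunP => u; rewrite zero_lfunE.
have -> : (alpha u : K) = 0; last by [].
by rewrite ac big1 ?mulr0 // => i _; rewrite c0 mulr0n.
Qed.

(** Engel's theorem is applied to the generalized eigenvectors of [ad t] in [I] for
    non-zero eigenvalues, with [t] as in the previous lemma. If the eigenvalues of
    two of them add up to zero, their bracket vanishes because [ad t] is injective
    on [I]. *)
Lemma isotropic_ideal_centralizer : I != 0%VS ->
  exists2 v, v \in I & v != 0 /\ forall x, x \in I -> ⁅x, v⁆ = 0.
Proof.
move=> I0.
have [t t1] := simple_roots_interpolate Pi_simple (fun=> 1).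
pose d := vsval t.
have reg x : x \in I -> gen_eigen (ad d) 0 x -> x = 0.
  move=> + [n]; elim: n x => [//|n IH] x xI; rewrite iterSr shiftE [0 *: x]scale0r subr0 adE.
  by move=> /(IH _ (idealE _ xI)); apply: lie_isotropic_regular t1 xI.
pose S := [set x | x \in I /\ exists2 a, a != 0 & gen_eigen (ad d) a x].
have S_lie x y : S x -> S y -> S ⁅x, y⁆.
  move=> [xI [a a0 xa]] [yI [b b0 yb]]; split; first exact: idealE.
  have [ab|ab] := eqVneq (a + b) 0; last by exists (a + b) => //; apply: gen_eigen_lie.
  have -> : ⁅x, y⁆ = 0.
    by apply: reg; [apply: idealE | rewrite -ab; apply: gen_eigen_lie].
  by exists 1; rewrite ?oner_eq0 //; exists 0%N.
have S_nil x : S x -> exists N, forall v, iter N (ad x) v = 0.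
  move=> [_ [a a0 xa]]; apply: (gen_eigen_shift_nilpotent (D := ad d) a0) => b v vb.
  by rewrite adE addrC; apply: gen_eigen_lie.
have [| | |v vI [v0 vS]] := @engel _ _ S S_lie S_nil I 0%VS _ _ (sub0v I).
- by move=> x v _; apply: idealE.
- by move=> x v _; rewrite !memv0 => /eqP ->; rewrite linear0.
- by rewrite eq_sym.
exists v => //; split; first by rewrite -memv0.
move=> x xI; have dI y : y \in I -> ad d y \in I by rewrite adE; apply: idealE.
elim: (gen_eigen_decomposition dI xI) => [a y yI ya|y z _ hy _ hz]; last first.
  by rewrite lieDl hy hz addr0.
have [a0|a0] := eqVneq a 0; first by rewrite (reg y yI) ?lie0l // -a0.
by apply/eqP; rewrite -memv0; apply: vS; split => //; exists a.
Qed.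

(** The center of an ideal is an abelian ideal of the whole algebra. *)
Lemma isotropic_ideal_eq0 : I = 0%VS.
Proof.
apply/eqP/negPn/negP => /isotropic_ideal_centralizer[v vI [v0 vC]].
pose C := (I :&: \bigcap_(i < \dim I) lker (ad (vbasis I)`_i))%VS.
have memC w : w \in C <-> w \in I /\ forall x, x \in I -> ⁅x, w⁆ = 0.
  rewrite memv_cap; split=> [/andP[-> wC]|[-> wC]]; last first.
    rewrite memvE; apply/subv_bigcapP => i _; rewrite -memvE memv_ker adE.
    by rewrite wC // vbasis_mem // mem_nth // size_tuple.
  split=> // x; rewrite -(span_basis (vbasisP I)) => xI; apply/eqP.
  rewrite -memv0; apply: span_lie xI => _ /(nthP 0)[i iI <-].
  rewrite size_tuple in iI; move: wC; rewrite memvE => /subv_bigcapP.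
  by move=> /(_ (Ordinal iI) isT); rewrite -memvE memv_ker adE memv0.
suff C0 : C = 0%VS.
  by move: v0; rewrite -memv0 -C0 => /negP; apply; apply/memC.
apply: g_semisimple.
  apply/(lie_prodP _ _ _) => x y _ /memC[yI yC]; apply/memC; split; first exact: idealE.
  move=> z zI; rewrite lie_deriv yC; last by rewrite lie_anti memvN idealE.
  by rewrite yC // linear0 addr0.
exists 1%N; apply/eqP; rewrite /= -subv0.
apply/(lie_prodP _ _ _) => x y /memC[xI _] /memC[_ yC].
by rewrite yC ?mem0v.
Qed.

End Ideal.

Lemma killing_nondegenerate (x : g) : (forall y, killing x y = 0) -> x = 0.
Proof.
pose I : {vspace g} :=
  (\bigcap_(i < \dim {:g}) lker (linfun (killing (vbasis {:g})`_i : g -> K^o)))%VS.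
have memI w : w \in I <-> forall y, killing w y = 0.
  split=> [|w0]; last first.
    rewrite memvE; apply/subv_bigcapP => i _.
    by rewrite -memvE memv_ker lfunE /= killingC w0.
  rewrite memvE => /subv_bigcapP wI y; rewrite (coord_vbasis (memvf y)) linear_sum.
  rewrite big1 // => i _; rewrite linearZ /= killingC.
  by have := wI i isT; rewrite -memvE memv_ker lfunE /= => /eqP ->; rewrite mulr0.
move=> /memI; rewrite (@isotropic_ideal_eq0 I).
- by rewrite memv0 => /eqP.
- apply/(lie_prodP _ _ _) => y z _ /memI zI; apply/memI => w.
  by rewrite lie_anti -linearN killing_inv zI.
- by move=> y /memI.
Qed.

End Nondegenerate.

(** By invariance a vector of the kernel of [C(e)] gives [x] in [U] such that [[e,x]]
    is orthogonal to [U]; it is also orthogonal to the centralizer of [e], thus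
    to [g]. *)
Lemma dirac_C_unit (K : fieldType) (g : lieAlgType K) (m : nat) (e : g)
    (U : {vspace g}) (X : m.-tuple g) :
    (forall x : g, (forall y, killing x y = 0) -> x = 0) ->
    directv (U + centralizer e) -> (U + centralizer e)%VS = fullv ->
    basis_of U X ->
  dirac_C X e \in unitmx.
Proof.
move=> nondeg /directv_addP cap0 full X_basis.
rewrite -row_free_unit -kermx_eq0; apply/rowV0P => u /sub_kermxP uC.
pose x := \sum_l u 0 l *: tnth X l.
have xU : x \in U.
  by apply: memv_suml => l _; rewrite memvZ // (basis_mem X_basis) // mem_tnth.
have exX l : killing ⁅e, x⁆ (tnth X l) = 0.
  have /rowP/(_ l) := uC; rewrite !mxE => <-.
  rewrite killing_inv lie_suml linear_sum; apply: eq_bigr => i _.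
  by rewrite lieZl linearZ mxE.
have ex0 : ⁅e, x⁆ = 0.
  apply: nondeg => y.
  have: y \in (U + centralizer e)%VS by rewrite full memvf.
  case/memv_addP => y1 y1U [y2]; rewrite memv_ker adE => /eqP ey2 ->.
  have -> : killing ⁅e, x⁆ (y1 + y2) = killing ⁅e, x⁆ y1.
    rewrite linearD /= (lie_anti e x) -scaleN1r [X in _ + X]killingZl killing_inv ey2.
    by rewrite linear0 mulr0 addr0.
  rewrite (coord_basis X_basis y1U) linear_sum big1 // => l _.
  by rewrite linearZ /= -(tnth_nth 0) exX mulr0.
have x0 : \sum_l u 0 l *: X`_l = 0.
  have : x \in (U :&: centralizer e)%VS by rewrite memv_cap xU memv_ker adE ex0 eqxx.
  rewrite cap0 memv0 => /eqP xz; rewrite -[RHS]xz.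
  by apply: eq_bigr => l _; rewrite (tnth_nth 0).
by apply/rowP => l; rewrite mxE; move/freeP: (basis_free X_basis) => /(_ _ x0 l).
Qed.

(** * Poisson brackets on polynomial rings *)

Section Biderivation.
Variables (K : numFieldType) (k : nat).
Local Notation pol := (mpoly k K).
Local Notation "''q_' i" := (mpolyX K (mnm1 i)) (at level 8, i at level 2).
Implicit Types (p q r : pol).

Lemma derivation_eq0 (d : pol -> pol) :
    linear d -> (forall p q, d (p * q) = d p * q + p * d q) ->
  (forall i, d 'q_i = 0) -> forall p, d p = 0.
Proof.
move=> d_lin dM d0 p.
pose dL : {linear pol -> pol} := HB.pack d (GRing.isLinear.Build _ _ _ _ d d_lin).
have d1 : d 1 = 0.
  have := dM 1 1; rewrite !mulr1 mul1r => /eqP.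
  by rewrite -subr_eq0 opprD addrA subrr sub0r oppr_eq0 => /eqP.
have dX q : d q = 0 -> forall n, d (q ^+ n) = 0.
  by move=> dq; elim=> [|n IH]; rewrite ?d1 // exprS dM dq IH mul0r mulr0 addr0.
rewrite (mpolyE p) -[d]/(dL : pol -> pol) linear_sum big1 // => m _.
rewrite linearZ /= mpolyXE_id.
have -> : d (\prod_(i < k) 'q_i ^+ m i) = 0; last by rewrite scaler0.
apply: (big_ind (fun q => d q = 0)) => // [q r dq dr|i _]; last exact: dX.
by rewrite dM dq dr mul0r mulr0 addr0.
Qed.

Variable br : pol -> pol -> pol.
Hypothesis br_linl : forall b, linear (fun a => br a b).
Hypothesis br_linr : forall a, linear (br a).
Hypothesis br_anti : forall a b, br a b = - br b a.
Hypothesis br_leib : forall a b c, br a (b * c) = br a b * c + b * br a c.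

Let jac a b c := br a (br b c) + br b (br c a) + br c (br a b).

Let brD a b c : br a (b + c) = br a b + br a c.
Proof. by have := br_linr a 1 b c; rewrite !scale1r. Qed.

Let br0 a : br a 0 = 0.
Proof.
have := brD a 0 0; rewrite addr0 => /eqP.
by rewrite -subr_eq0 opprD addrA subrr sub0r oppr_eq0 => /eqP.
Qed.

Let brZ a (x : K) b : br a (x *: b) = x *: br a b.
Proof. by have := br_linr a x b 0; rewrite br0 !addr0. Qed.

Let brN a b : br a (- b) = - br a b.
Proof. by rewrite -scaleN1r brZ scaleN1r. Qed.

Let jacE a b c : jac a b c = br a (br b c) - br b (br a c) - br (br a b) c.
Proof. by rewrite /jac (br_anti c a) brN (br_anti c (br a b)). Qed.

Let jac_cyc a b c : jac a b c = jac b c a.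
Proof. by rewrite /jac -addrA addrC. Qed.

(** The Jacobiator of an antisymmetric biderivation is a derivation in its last
    argument, and it is invariant under cyclic permutations. *)
Lemma jacobi_on_generators : (forall i j l, jac 'q_i 'q_j 'q_l = 0) ->
  forall a b c, jac a b c = 0.
Proof.
have jac0 a b : (forall i, jac a b 'q_i = 0) -> forall c, jac a b c = 0.
  move=> abq c; apply: (@derivation_eq0 (jac a b)) => [x u v|u v|i]; last exact: abq.
    by rewrite !jacE !brD !brZ -!mul_mpolyC; ring.
  by rewrite !jacE !br_leib !brD !br_leib; ring.
move=> jq a b c; apply: (jac0 _ _ _) => i; rewrite -jac_cyc; apply: (jac0 _ _ _) => j.
by rewrite -jac_cyc; apply: (jac0 _ _ _) => l; rewrite jac_cyc jac_cyc.
Qed.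

End Biderivation.

Section PolynomialBracket.
Variables (K : numFieldType) (k : nat).
Local Notation pol := (mpoly k K).
Local Notation "''q_' i" := (mpolyX K (mnm1 i)) (at level 8, i at level 2).

Definition matrix_bracket (P : 'M[pol]_k) (a b : pol) : pol :=
  \sum_i \sum_j P i j * (mderiv i a * mderiv j b).

Lemma mderiv_q (i j : 'I_k) : mderiv i 'q_j = (i == j)%:R.
Proof.
rewrite mderivX mnm1E eq_sym; have [->|_] := eqVneq i j; last by rewrite scale0r.
rewrite scale1r -[RHS](mpolyX0 k K); congr (mpolyX K _).
by apply/mnmP => a; rewrite mnmBE subnn mnm0E.
Qed.

Lemma matrix_bracket_gen P i (b : pol) :
  matrix_bracket P 'q_i b = \sum_j P i j * mderiv j b.
Proof.
rewrite /matrix_bracket (bigD1 i) //= [X in _ + X]big1 ?addr0 => [|i' ne].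
  by apply: eq_bigr => j _; rewrite mderiv_q eqxx mul1r.
by apply: big1 => j _; rewrite mderiv_q (negPf ne) mul0r mulr0.
Qed.

Lemma matrix_bracket_gens P i j : matrix_bracket P 'q_i 'q_j = P i j.
Proof.
rewrite matrix_bracket_gen (bigD1 j) //= [X in _ + X]big1 ?addr0 => [|j' ne].
  by rewrite mderiv_q eqxx mulr1.
by rewrite mderiv_q (negPf ne) mulr0.
Qed.

Lemma matrix_bracket_poisson (P : 'M[pol]_k) : P^T = - P ->
    (forall i j l, \sum_p P i p * mderiv p (P j l) + \sum_p P j p * mderiv p (P l i) +
                   \sum_p P l p * mderiv p (P i j) = 0) ->
  is_poisson_bracket (matrix_bracket P).
Proof.
move=> P_anti P_jac.
have linl b : linear (fun a => matrix_bracket P a b).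
  move=> c u v; rewrite /matrix_bracket scaler_sumr -big_split; apply: eq_bigr => i _.
  rewrite scaler_sumr -big_split; apply: eq_bigr => j _ /=.
  by rewrite linearP /= -!mul_mpolyC; ring.
have linr a : linear (matrix_bracket P a).
  move=> c u v; rewrite /matrix_bracket scaler_sumr -big_split; apply: eq_bigr => i _.
  rewrite scaler_sumr -big_split; apply: eq_bigr => j _ /=.
  by rewrite linearP /= -!mul_mpolyC; ring.
have anti a b : matrix_bracket P a b = - matrix_bracket P b a.
  rewrite /matrix_bracket exchange_big /= -sumrN; apply: eq_bigr => j _.
  rewrite -sumrN; apply: eq_bigr => i _.
  by have /matrixP/(_ j i) := P_anti; rewrite !mxE => ->; ring.
have leib a b c : matrix_bracket P a (b * c) =
                  matrix_bracket P a b * c + b * matrix_bracket P a c.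
  rewrite /matrix_bracket mulr_suml mulr_sumr -big_split; apply: eq_bigr => i _.
  rewrite mulr_suml mulr_sumr -big_split; apply: eq_bigr => j _ /=.
  by rewrite mderivM; ring.
split => //.
  move=> a; have /eqP := anti a a; rewrite -addr_eq0 -mulr2n -scaler_nat.
  by rewrite scaler_eq0 pnatr_eq0 /= => /eqP.
apply: jacobi_on_generators => // i j l.
by rewrite !matrix_bracket_gens !matrix_bracket_gen; apply: P_jac.
Qed.

End PolynomialBracket.

(** * Dirac reduction on a slice *)

Section DiracJacobi.
Variables (K : numFieldType) (k m : nat) (g : lieAlgType K).
Local Notation pol := (mpoly k K).
Variables (T : (k + m).-tuple g) (xi : {linear g -> pol}).
Hypothesis T_basis : basis_of fullv T.
Hypothesis xi_deriv : forall l x, mderiv l (xi x) = mpolyC k (coord T (lshift m l) x).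

Definition bracket_mx : 'M[pol]_(k + m) := \matrix_(a, b) xi ⁅tnth T a, tnth T b⁆.

Variable E : 'M[pol]_(k, m).
Let M : 'M[pol]_(k, k + m) := row_mx 1%:M E.
(** The rows of [M] are orthogonal to the constraints for the bracket. *)
Hypothesis ME : rsubmx (M *m bracket_mx) = 0.

Definition reduced_mx := M *m bracket_mx *m M^T.

Lemma bracket_mx_anti : bracket_mx^T = - bracket_mx.
Proof. by apply/matrixP => a b; rewrite !mxE lie_anti linearN. Qed.

Lemma reduced_mx_anti : reduced_mx^T = - reduced_mx.
Proof. by rewrite /reduced_mx !trmx_mul trmxK bracket_mx_anti mulNmx mulmxN mulmxA. Qed.

Lemma mul_bracket_mx : M *m bracket_mx = row_mx reduced_mx 0.
Proof.
rewrite /reduced_mx -{1 2}[M *m bracket_mx]hsubmxK ME /M tr_row_mx mul_row_col.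
by rewrite trmx1 mulmx1 mul0mx addr0.
Qed.

Lemma mderiv_mulmx (l : 'I_k) a b c (A : 'M[pol]_(a, b)) (B : 'M[pol]_(b, c)) :
  map_mx (mderiv l) (A *m B) = map_mx (mderiv l) A *m B + A *m map_mx (mderiv l) B.
Proof.
apply/matrixP => i j; rewrite !mxE linear_sum -big_split; apply: eq_bigr => h _ /=.
by rewrite mderivM !mxE.
Qed.

(** [M] varies only in its last columns, where [M *m bracket_mx] vanishes. *)
Lemma mderiv_reduced_mx l :
  map_mx (mderiv l) reduced_mx = M *m map_mx (mderiv l) bracket_mx *m M^T.
Proof.
have dM : map_mx (mderiv l) M = row_mx 0 (map_mx (mderiv l) E).
  rewrite map_row_mx; congr row_mx; apply/matrixP => i j; rewrite !mxE.
  by case: eqP => _; rewrite ?mulr1n ?mulr0n ?mderiv0 // -mpolyC1 mderivC.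
rewrite /reduced_mx 2!mderiv_mulmx mulmxDl -map_trmx dM.
have -> : row_mx 0 (map_mx (mderiv l) E) *m bracket_mx *m M^T = 0.
  rewrite -mulmxA -[bracket_mx *m M^T]trmxK trmx_mul trmxK bracket_mx_anti mulmxN.
  rewrite mul_bracket_mx raddfN /= tr_row_mx mulmxN mul_row_col mul0mx trmx0 mulmx0.
  by rewrite addr0 oppr0.
rewrite mul_bracket_mx [(row_mx 0 _)^T]tr_row_mx mul_row_col trmx0 mulmx0 mul0mx.
by rewrite add0r !addr0.
Qed.

Let cubic i j l := \sum_c \sum_a \sum_b
  M i c * M j a * M l b * xi ⁅tnth T c, ⁅tnth T a, tnth T b⁆⁆.

(** Since [M *m bracket_mx] vanishes in the last columns, the sum over the
    coordinates extends to the whole basis [T], and the coordinates of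
    [[T_a,T_b]] reassemble into this bracket. *)
Lemma mderiv_reduced_cubic i j l :
  \sum_p reduced_mx i p * mderiv p (reduced_mx j l) = cubic i j l.
Proof.
have dL p a b : mderiv p (bracket_mx a b) =
    mpolyC k (coord T (lshift m p) ⁅tnth T a, tnth T b⁆).
  by rewrite mxE xi_deriv.
have ham a b :
    \sum_p reduced_mx i p * mpolyC k (coord T (lshift m p) ⁅tnth T a, tnth T b⁆) =
               \sum_c M i c * xi ⁅tnth T c, ⁅tnth T a, tnth T b⁆⁆.
  set x := ⁅tnth T a, tnth T b⁆.
  transitivity (\sum_d (M *m bracket_mx) i d * mpolyC k (coord T d x)).
    rewrite big_split_ord /= [X in _ = _ + X]big1 ?addr0 => [|p _].
      by apply: eq_bigr => p _; rewrite mul_bracket_mx row_mxEl.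
    by rewrite mul_bracket_mx row_mxEr mxE mul0r.
  under eq_bigr => d _ do rewrite mxE mulr_suml.
  rewrite exchange_big; apply: eq_bigr => c _.
  rewrite [in RHS](coord_basis T_basis (memvf x)) !linear_sum mulr_sumr.
  apply: eq_bigr => d _; rewrite !linearZ /=.
  by rewrite [bracket_mx _ _]mxE -(tnth_nth 0) -mul_mpolyC; ring.
have dP p : mderiv p (reduced_mx j l) = \sum_a \sum_b
    M j a * M l b * mpolyC k (coord T (lshift m p) ⁅tnth T a, tnth T b⁆).
  have /matrixP/(_ j l) := mderiv_reduced_mx p; rewrite mxE => ->.
  rewrite mxE exchange_big; apply: eq_bigr => b _; rewrite mxE mulr_suml.
  by apply: eq_bigr => a _; rewrite [map_mx _ _ _ _]mxE dL [M^T _ _]mxE; ring.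
transitivity (\sum_a \sum_b M j a * M l b *
    \sum_c M i c * xi ⁅tnth T c, ⁅tnth T a, tnth T b⁆⁆).
  under eq_bigr => p _ do rewrite dP mulr_sumr.
  rewrite exchange_big; apply: eq_bigr => a _.
  under eq_bigr => p _ do rewrite mulr_sumr.
  rewrite exchange_big; apply: eq_bigr => b _.
  by rewrite -ham mulr_sumr; apply: eq_bigr => p _; ring.
rewrite /cubic [RHS]exchange_big; apply: eq_bigr => a _ /=.
rewrite [RHS]exchange_big; apply: eq_bigr => b _ /=.
by rewrite mulr_sumr; apply: eq_bigr => c _; ring.
Qed.

Lemma reduced_mx_jacobi i j l : cubic i j l + cubic j l i + cubic l i j = 0.
Proof.
have -> : cubic j l i = \sum_c \sum_a \sum_b
    M i c * M j a * M l b * xi ⁅tnth T a, ⁅tnth T b, tnth T c⁆⁆.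
  rewrite [RHS]exchange_big; apply: eq_bigr => a _.
  rewrite [RHS]exchange_big; apply: eq_bigr => b _.
  by apply: eq_bigr => c _; ring.
have -> : cubic l i j = \sum_c \sum_a \sum_b
    M i c * M j a * M l b * xi ⁅tnth T b, ⁅tnth T c, tnth T a⁆⁆.
  rewrite /cubic exchange_big; apply: eq_bigr => c _.
  rewrite exchange_big; apply: eq_bigr => a _.
  by apply: eq_bigr => b _; ring.
rewrite -!big_split big1 // => c _; rewrite -!big_split big1 // => a _.
rewrite -!big_split big1 // => b _ /=.
by rewrite -!mulrDr -!linearD /= lie_jacobi linear0 mulr0.
Qed.

Lemma reduced_mx_poisson : is_poisson_bracket (matrix_bracket reduced_mx).
Proof.
apply: matrix_bracket_poisson => [|i j l]; first exact: reduced_mx_anti.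
by rewrite !mderiv_reduced_cubic reduced_mx_jacobi.
Qed.

End DiracJacobi.

(** * Scaling of the variables *)

Section Scaling.
Variables (K : numFieldType) (k : nat) (nu : 'I_k -> nat).
Local Notation pol := (mpoly k K).
Local Notation "''q_' i" := (mpolyX K (mnm1 i)) (at level 8, i at level 2).

Definition scale_vars (t : K) : pol -> pol :=
  comp_mpoly [tuple t ^+ nu i *: 'q_i | i < k].

HB.instance Definition _ t := GRing.LRMorphism.on (scale_vars t).

Lemma scale_vars_q t i : scale_vars t 'q_i = t ^+ nu i *: 'q_i.
Proof. by rewrite /scale_vars comp_mpolyXU -tnth_nth tnth_mktuple. Qed.

Lemma mcoeff_scale_vars t p mu :
  mcoeff mu (scale_vars t p) = (\prod_i t ^+ (nu i * mu i)) * mcoeff mu p.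
Proof.
rewrite /scale_vars comp_mpolyE {3}(mpolyE p) !linear_sum mulr_sumr.
apply: eq_bigr => l _ /=.
have -> : \prod_(i < k) tnth [tuple t ^+ nu i *: 'q_i | i < k] i ^+ l i =
          (\prod_i t ^+ (nu i * l i)) *: mpolyX K l.
  rewrite mpolyXE_id -scaler_prod; apply: eq_bigr => i _.
  by rewrite tnth_mktuple exprZn exprM.
rewrite !mcoeffZ mcoeffX; case: eqP => [->|_]; last by rewrite !mulr0.
by rewrite mulrCA.
Qed.

(** The non-zero constant term forces [s = 1]; then a monomial can only occur if its
    weighted degree [d] satisfies [2 ^ d = 1]. *)
Lemma scale_vars_const p s : (forall i, 0 < nu i)%N ->
  scale_vars 2 p = s *: p -> mcoeff mnm0 p != 0 -> p = mpolyC k (mcoeff mnm0 p).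
Proof.
move=> nu_gt0 ps p0.
have pmu (mu : multinom k) : \prod_i (2 : K) ^+ (nu i * mu i) * mcoeff mu p = s * mcoeff mu p.
  by rewrite -mcoeff_scale_vars ps mcoeffZ.
have s1 : s = 1.
  apply: (mulIf p0); rewrite -pmu big1 // => i _.
  by rewrite mnm0E muln0.
apply/mpolyP => mu; rewrite mcoeffC.
have [->|mu0] := eqVneq mu mnm0; first by rewrite mulr1.
rewrite mulr0; apply/eqP; apply: contraNT mu0 => pmu0.
have /(mulIf pmu0) : \prod_i (2 : K) ^+ (nu i * mu i) * mcoeff mu p = 1 * mcoeff mu p.
  by rewrite pmu s1.
rewrite prodrXr => /eqP; rewrite pexprn_eq1 ?ler0n // pnatr_eq1 orbF.
rewrite sum_nat_eq0 => /forallP mu_eq0; apply/eqP/mnmP => i; rewrite mnm0E; apply/eqP.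
by have := mu_eq0 i; rewrite /= muln_eq0 eqn0Ngt nu_gt0.
Qed.

End Scaling.

(** * The transverse structure as a polynomial bracket *)

Section TransversePolynomial.
Variables (K : numFieldType) (g : lieAlgType K) (k m : nat).
Variables (e : g) (Z : k.-tuple g) (X : m.-tuple g).
Local Notation pol := (mpoly k K).
Local Notation "''q_' i" := (mpolyX K (mnm1 i)) (at level 8, i at level 2).
Let T := cat_tuple Z X.
Hypothesis T_basis : basis_of fullv T.

(** The function [y |-> <y|x>] on the slice [e + U^⊥], in the coordinates [q_i]:
    an element of [U^⊥] pairs with [x] through the [Z]-part of [x] only. *)
Definition slice_form (x : g) : pol :=
  mpolyC k (killing e x) + \sum_(i < k) coord T (lshift m i) x *: 'q_i.

Lemma slice_form_linear : linear slice_form.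
Proof.
move=> c x y; rewrite /slice_form linearP mpolyCD mpolyCM mul_mpolyC scalerDr addrACA.
congr (_ + _); rewrite scaler_sumr -big_split; apply: eq_bigr => i _ /=.
by rewrite linearP scalerDl scalerA.
Qed.

HB.instance Definition _ :=
  GRing.isLinear.Build K g pol *:%R slice_form slice_form_linear.

Lemma mderiv_slice_form l x :
  mderiv l (slice_form x) = mpolyC k (coord T (lshift m l) x).
Proof.
rewrite linearD /= mderivC add0r linear_sum (bigD1 l) //= big1 => [|i il].
  by rewrite linearZ /= mderiv_q eqxx addr0 -mul_mpolyC mulr1.
by rewrite linearZ /= mderiv_q eq_sym (negPf il) scaler0.
Qed.

Lemma slice_form_eval (U : {vspace g}) y x : (forall l, tnth X l \in U) ->
  slice e U y -> meval (slice_coord e Z y) (slice_form x) = killing y x.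
Proof.
move=> XU [z zU <-]; rewrite mevalD mevalC killingDl; congr (_ + _).
rewrite [in RHS](coord_basis T_basis (memvf x)) big_split_ord linearD /= !linear_sum /=.
rewrite [X in _ = _ + X]big1 => [|i _]; last first.
  rewrite nth_cat size_tuple ltnNge leq_addr addKn -tnth_nth linearZ /=.
  by rewrite zU ?mulr0.
rewrite addr0; apply: eq_bigr => i _.
rewrite mevalZ mevalXU nth_cat size_tuple ltn_ord -tnth_nth linearZ /=.
by rewrite /slice_coord addrC addKr.
Qed.

Local Notation L := (bracket_mx T slice_form).

Lemma ulsubmx_bracket : ulsubmx L = \matrix_(i, j) slice_form ⁅tnth Z i, tnth Z j⁆.
Proof. by apply/matrixP => i j; rewrite !mxE !tnth_lshift. Qed.

Lemma ursubmx_bracket : ursubmx L = \matrix_(i, j) slice_form ⁅tnth Z i, tnth X j⁆.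
Proof. by apply/matrixP => i j; rewrite !mxE tnth_lshift tnth_rshift. Qed.

Lemma drsubmx_bracket : drsubmx L = \matrix_(i, j) slice_form ⁅tnth X i, tnth X j⁆.
Proof. by apply/matrixP => i j; rewrite !mxE !tnth_rshift. Qed.

Lemma dlsubmx_bracket : dlsubmx L = - (ursubmx L)^T.
Proof.
by apply/matrixP => i j; rewrite ursubmx_bracket !mxE tnth_lshift tnth_rshift lie_anti linearN.
Qed.

(** [G] stands for the inverse of the constraint matrix, given as a matrix of
    polynomials. *)
Variable G : 'M[pol]_m.
Hypothesis CG : drsubmx L *m G = 1%:M.

Let GC : G *m drsubmx L = 1%:M. Proof. exact: mulmx1C. Qed.

Definition dirac_mx := reduced_mx T slice_form (- (ursubmx L *m G)).

Lemma dirac_constraint : rsubmx (row_mx 1%:M (- (ursubmx L *m G)) *m L) = 0.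
Proof.
rewrite -[in LHS](submxK L) mul_row_block row_mxKr.
by rewrite submxK mul1mx mulNmx -mulmxA GC mulmx1 subrr.
Qed.

Lemma dirac_mxE : dirac_mx = ulsubmx L + ursubmx L *m G *m (ursubmx L)^T.
Proof.
rewrite /dirac_mx; have := mul_bracket_mx dirac_constraint => /(congr1 lsubmx).
rewrite row_mxKl => <-; rewrite -{2}(submxK L) mul_row_block row_mxKl.
by rewrite dlsubmx_bracket mul1mx mulNmx mulmxN opprK.
Qed.

Lemma dirac_mx_poisson : is_poisson_bracket (matrix_bracket dirac_mx).
Proof. exact: (reduced_mx_poisson T_basis mderiv_slice_form dirac_constraint). Qed.

Lemma dirac_mx_transverse (U : {vspace g}) : (forall l, tnth X l \in U) ->
    dirac_C X e \in unitmx -> transverse_poisson e U Z X (matrix_bracket dirac_mx).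
Proof.
move=> XU Ce; split=> // y yS Cy i j; rewrite matrix_bracket_gens dirac_mxE.
have ev a b (u : 'I_a -> g) (v : 'I_b -> g) :
    map_mx (meval (slice_coord e Z y)) (\matrix_(i, j) slice_form ⁅u i, v j⁆) =
    \matrix_(i, j) killing y ⁅u i, v j⁆.
  by apply/matrixP => i' j'; rewrite !mxE (slice_form_eval _ XU yS).
have GE : map_mx (meval (slice_coord e Z y)) G = invmx (dirac_C X y).
  apply: (can_inj (mulKmx Cy)); rewrite mulmxV //.
  by rewrite -[dirac_C X y](ev _ _ (tnth X) (tnth X)) -drsubmx_bracket -map_mxM CG map_mx1.
transitivity ((map_mx (meval (slice_coord e Z y))
  (ulsubmx L + ursubmx L *m G *m (ursubmx L)^T)) i j); last by rewrite mxE.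
rewrite map_mxD !map_mxM -map_trmx GE ulsubmx_bracket ursubmx_bracket.
by rewrite !(ev _ _ (tnth Z)).
Qed.

End TransversePolynomial.

(** * Weights *)

Section QuasiHomogeneous.
Variables (K : numFieldType) (g : lieAlgType K) (k m : nat).
Variables (h e : g) (Z : k.-tuple g) (X : m.-tuple g).
Local Notation pol := (mpoly k K).
Local Notation "''q_' i" := (mpolyX K (mnm1 i)) (at level 8, i at level 2).
Let T := cat_tuple Z X.
Hypothesis T_basis : basis_of fullv T.
Hypothesis he : ⁅h, e⁆ = 2 *: e.
Variables (n : 'I_k -> nat) (w : 'I_m -> int).
Hypothesis Z_weight : forall i, ⁅h, tnth Z i⁆ = (n i)%:R *: tnth Z i.
Hypothesis X_weight : forall l, ⁅h, tnth X l⁆ = (w l)%:~R *: tnth X l.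
Let nu i := (n i + 2)%N.

Let Z_weightz i : ⁅h, tnth Z i⁆ = (n i)%:Z%:~R *: tnth Z i.
Proof. exact: Z_weight. Qed.

(** The form pairs the weight spaces of opposite weights, and [e] has weight [2]. *)
Lemma killing_weight (x : g) (z : int) :
  ⁅h, x⁆ = z%:~R *: x -> killing e x != 0 -> z = - 2.
Proof.
move=> hx ex0; have /eqP : (2 + z%:~R) * killing e x = 0.
  have := killing_inv e h x; rewrite lie_anti he hx -scaleNr killingZl linearZ /=.
  by rewrite mulrDl => <-; rewrite mulNr addrN.
rewrite mulf_eq0 (negPf ex0) orbF -[2]/(2%:~R) -intrD intr_eq0 addr_eq0.
by move=> /eqP ->; rewrite opprK.
Qed.

Lemma coord_weight (x : g) (z : int) i :
  ⁅h, x⁆ = z%:~R *: x -> coord T (lshift m i) x != 0 -> z = n i.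
Proof.
move=> hx x0; pose lam (a : 'I_(k + m)) : K :=
  match fintype.split a with inl i => (n i)%:R | inr l => (w l)%:~R end.
have hT a : ⁅h, tnth T a⁆ = lam a *: tnth T a.
  rewrite /lam /T; case: split_ordP => b ->.
    by rewrite tnth_lshift Z_weight.
  by rewrite tnth_rshift X_weight.
have : coord T (lshift m i) ⁅h, x⁆ = (n i)%:R * coord T (lshift m i) x.
  rewrite {1}(coord_basis T_basis (memvf x)) linear_sum /=.
  under eq_bigr => a _ do rewrite linearZ /= -(tnth_nth 0) hT scalerA (tnth_nth 0).
  rewrite coord_sum_free ?(basis_free T_basis) // mulrC /lam.
  by case: split_ordP => b /eqP; rewrite (eq_lshift, eq_lrshift) // => /eqP ->.
rewrite hx linearZ /= => /(mulIf x0) /eqP.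
by rewrite -[(n i)%:R]/((n i)%:~R) eqr_int => /eqP.
Qed.

Lemma scale_slice_form (t : K) (x : g) (z : int) : t != 0 -> ⁅h, x⁆ = z%:~R *: x ->
  scale_vars nu t (slice_form e Z X x) = t ^ (z + 2) *: slice_form e Z X x.
Proof.
move=> t0 hx; rewrite linearD /= scalerDr linear_sum scaler_sumr.
congr (_ + _).
  rewrite /scale_vars comp_mpolyC -mul_mpolyC -mpolyCM.
  have [->|/(killing_weight hx) ->] := eqVneq (killing e x) 0; first by rewrite mulr0.
  by rewrite addNr expr0z mul1r.
apply: eq_bigr => i _; rewrite linearZ /= scale_vars_q scalerA scalerA.
have [->|/(coord_weight hx) ->] := eqVneq (coord T (lshift m i) x) 0.
  by rewrite mulr0 mul0r !scale0r.
by rewrite mulrC.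
Qed.

Lemma lie_weight (x y : g) (a b : int) :
    ⁅h, x⁆ = a%:~R *: x -> ⁅h, y⁆ = b%:~R *: y ->
  ⁅h, ⁅x, y⁆⁆ = (a + b)%:~R *: ⁅x, y⁆.
Proof. by move=> hx hy; rewrite lie_deriv hx hy lieZl linearZ /= intrD scalerDl. Qed.

Local Notation L := (bracket_mx T (slice_form e Z X)).

Let scale_ul (t : K) i j : t != 0 ->
  scale_vars nu t (ulsubmx L i j) = t ^ (n i + n j + 2)%:Z *: ulsubmx L i j.
Proof.
move=> t0; rewrite ulsubmx_bracket mxE.
rewrite (scale_slice_form t0 (lie_weight (Z_weightz _) (Z_weightz _))).
by congr (_ ^ _ *: _); lia.
Qed.

Let scale_ur (t : K) i l : t != 0 ->
  scale_vars nu t (ursubmx L i l) = t ^ ((n i)%:Z + w l + 2) *: ursubmx L i l.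
Proof.
move=> t0; rewrite ursubmx_bracket mxE.
by rewrite (scale_slice_form t0 (lie_weight (Z_weightz _) (X_weight _))).
Qed.

Let scale_dr (t : K) l l' : t != 0 ->
  scale_vars nu t (drsubmx L l l') = t ^ (w l + w l' + 2) *: drsubmx L l l'.
Proof.
move=> t0; rewrite drsubmx_bracket mxE.
by rewrite (scale_slice_form t0 (lie_weight (X_weight _) (X_weight _))).
Qed.

(** Scaling the variables multiplies the entry [(l, l')] of [C] by
    [t ^ (w l + w l' + 2)], hence its determinant by a scalar; [2] is not a root of
    unity, so [t = 2] suffices. *)
Lemma det_constraint_const : dirac_C X e \in unitmx ->
  exists2 c, c != 0 & \det (drsubmx L) = mpolyC k c.
Proof.
rewrite unitmxE unitfE => C0.
have cE : mcoeff mnm0 (\det (drsubmx L)) = \det (dirac_C X e).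
  rewrite -det_map_mx drsubmx_bracket; congr (\det _); apply/matrixP => i j.
  rewrite !mxE /= /slice_form mcoeffD mcoeffC eqxx mulr1 linear_sum big1 ?addr0 // => l _.
  rewrite linearZ /= mcoeffX; case: eqP => [/mnmP/(_ l)|_]; last by rewrite mulr0.
  by rewrite mnm1E eqxx mnm0E.
exists (\det (dirac_C X e)) => //; rewrite -cE.
apply: (@scale_vars_const _ _ nu _
    (\prod_l 2 ^ (w l + 2) * \prod_l 2 ^ (w l))) => [i||]; last by rewrite cE.
  by rewrite /nu addn2.
rewrite -det_map_mx.
(* The exponent [w l + w l' + 2] is split between row [l] and column [l']. *)
have -> : map_mx (scale_vars nu 2) (drsubmx L) =
    diag_mx (\row_l mpolyC k (2 ^ (w l + 2))) *m drsubmx L *m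
    diag_mx (\row_l mpolyC k (2 ^ (w l))).
  apply/matrixP => i j; rewrite mul_mx_diag mul_diag_mx [LHS]mxE scale_dr ?pnatr_eq0 //.
  rewrite [X in _ = X]mxE [X in X * _]mxE [X in X * _ * _]mxE [X in _ * X]mxE.
  rewrite -mulrA (mulrC (drsubmx L i j)) mulrA -mpolyCM mul_mpolyC -expfzDr ?pnatr_eq0 //.
  by congr (_ ^ _ *: _); lia.
rewrite !det_mulmx !det_diag -mul_mpolyC mpolyCM !rmorph_prod /=.
under [X in X * _ * _]eq_bigr => i _ do rewrite mxE.
under [X in _ * X]eq_bigr => i _ do rewrite mxE.
by rewrite mulrAC.
Qed.

Section Inverse.
Variable G : 'M[pol]_m.
Hypothesis CG : drsubmx L *m G = 1%:M.

(** Rescaling the entries of the transformed [G] gives another inverse of [C]. *)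
Let scale_G (t : K) l l' : t != 0 ->
  scale_vars nu t (G l l') = t ^ (- (w l + w l' + 2)) *: G l l'.
Proof.
move=> t0.
pose G' := \matrix_(a, b) (t ^ (w a + w b + 2) *: scale_vars nu t (G a b)).
have CG' : drsubmx L *m G' = 1%:M.
  apply/matrixP => a b; rewrite [LHS]mxE [RHS]mxE.
  transitivity (t ^ (w b - w a) *: scale_vars nu t ((drsubmx L *m G) a b)); last first.
    rewrite CG mxE; have [->|_] := eqVneq a b; last by rewrite linear0 scaler0.
    by rewrite subrr expr0z scale1r rmorph1.
  rewrite [(_ *m G) a b]mxE rmorph_sum scaler_sumr; apply: eq_bigr => c _ /=.
  rewrite rmorphM /= scale_dr // [G' _ _]mxE -scalerAr -scalerAl scalerA -expfzDr //.
  by congr (_ ^ _ *: _); lia.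
have /matrixP/(_ l l') : G' = G.
  by rewrite -[G']mul1mx -(mulmx1C CG) -mulmxA CG' mulmx1.
by rewrite mxE => Gll; rewrite -[in RHS]Gll scalerA -expfzDr // addNr expr0z scale1r.
Qed.

Lemma dirac_mx_quasi_homogeneous :
  quasi_homogeneous_poisson nu (- 2%:Z) (matrix_bracket (dirac_mx e Z X G)).
Proof.
move=> i j t t0; rewrite matrix_bracket_gens (dirac_mxE CG) -/(scale_vars nu t).
have -> : (ulsubmx L + ursubmx L *m G *m (ursubmx L)^T) i j = ulsubmx L i j +
    \sum_l' \sum_l ursubmx L i l * G l l' * ursubmx L j l'.
  rewrite [LHS]mxE [X in _ + X]mxE; congr (_ + _); apply: eq_bigr => l' _.
  by rewrite [(_ *m G) _ _]mxE [(_^T) _ _]mxE mulr_suml.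
rewrite linearD scalerDr /= scale_ul //.
congr (_ + _); first by congr (_ ^ _ *: _); rewrite /nu; lia.
rewrite rmorph_sum scaler_sumr; apply: eq_bigr => l' _ /=.
rewrite rmorph_sum scaler_sumr; apply: eq_bigr => l _ /=.
rewrite !rmorphM /= !scale_ur // scale_G // -!scalerAl -!scalerAr -!scalerAl !scalerA.
by rewrite -!expfzDr //; congr (_ ^ _ *: _); rewrite /nu; lia.
Qed.

End Inverse.
End QuasiHomogeneous.

Theorem proposition3p3 (R : realType) (g : lieAlgType R[i])
    (g_semisimple : lie_semisimple g)
    (H : {vspace g}) (H_cartan : cartan_subalgebra H)
    (Pi : seq 'Hom(subvs_of H, R[i]^o)) (Pi_simple : simple_roots Pi)
    (O : set g) (O_nilpotent : nilpotent_orbit O)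
    (h e f : g) (hef_canonical : canonical_triple Pi O h e f)
    (s : {vspace g}) (s_generated : generated_subalgebra [:: h; e; f] s)
    (k : nat) (n : 'I_k -> nat) (n_weights : simple_decomposition h e s n)
    (U : {vspace g}) (U_Nh : in_Nh h e U)
    (Z : k.-tuple g) (Z_basis : basis_of (centralizer e) Z)
    (Z_weight : forall i, ⁅h, tnth Z i⁆ = (n i)%:R *: tnth Z i)
    (r : nat) (X : (2 * r).-tuple g) (X_basis : basis_of U X)
    (X_weight : forall l, exists w : R[i], ⁅h, tnth X l⁆ = w *: tnth X l) :
  exists br : mpoly k R[i] -> mpoly k R[i] -> mpoly k R[i],
    [/\ is_poisson_bracket br,
        transverse_poisson e U Z X br &
        quasi_homogeneous_poisson (fun i => (n i + 2)%N) (- 2%:Z) br].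
Proof.
have [[he _ _] hH Pi_h _] := hef_canonical.
have [_ dirUe fullUe] := U_Nh.
have T_basis : basis_of fullv (cat_tuple Z X).
  rewrite -fullUe addvC; apply: cat_basis => //; apply/directv_addP.
  by rewrite capvC; apply/directv_addP.
have XU l : tnth X l \in U by rewrite (basis_mem X_basis) ?mem_tnth.
have /choice[w X_weightz] : forall l, exists z : int, ⁅h, tnth X l⁆ = z%:~R *: tnth X l.
  move=> l.
  have [a hX] := X_weight l.
  have X0 : tnth X l != 0 by rewrite (basis_not0 X_basis) ?mem_tnth.
  have [z az] := cartan_eigenvalue_int H_cartan Pi_simple hH Pi_h X0 hX.
  by exists z; rewrite -az.
have C_unit : dirac_C X e \in unitmx.
  apply: dirac_C_unit dirUe fullUe X_basis.
  exact (killing_nondegenerate g_semisimple H_cartan Pi_simple).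
have [c c0 detC] := det_constraint_const T_basis he Z_weight X_weightz C_unit.
set C := drsubmx _ in detC.
pose G := mpolyC k c^-1 *: \adj C.
have CG : C *m G = 1%:M.
  by rewrite /G -scalemxAr mul_mx_adj detC scale_scalar_mx -mpolyCM mulVf ?mpolyC1.
exists (matrix_bracket (dirac_mx e Z X G)); split.
- exact (dirac_mx_poisson T_basis CG).
- exact (dirac_mx_transverse T_basis CG XU C_unit).
- exact (dirac_mx_quasi_homogeneous T_basis he Z_weight X_weightz CG).
Qed.
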